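(* Let $\Delta_v$ be an interior cell in $\mathbb{R}^2$ consisting of $m$ triangles, and suppose there are $m_v$ different slopes among the interior edges of $\Delta_v$. Then for every integer $r\ge 0$, $$\operatorname{mos} S^r(\Delta_v)=\begin{cases} r+\left\lfloor \dfrac{r+1}{m-1}\right\rfloor, & m_v=m;\\[2mm] r, & m_v<m.\end{cases}$$
   Context: An interior cell $\Delta_v$ in $\mathbb{R}^2$ with $m$ triangles is a set of $m$ (closed, nondegenerate) triangles, all having the point $v$ as a vertex, such that any two distinct triangles intersect in a common vertex or a common edge, and such that $v$ lies in the interior of $\Omega_v=\bigcup\{T:T\in\Delta_v\}$ (so $m\ge3$). Its interior edges are the $m$ edges of the triangles that contain $v$; two interior edges have the same slope if they lie on the same line through $v$, so $m_v$ is the number of distinct lines through $v$ containing interior edges. A spline on $\Delta_v$ is a family $\sigma=\{(U_T,f_T): T\in\Delta_v\}$ with, for each $T$, $U_T\subset\mathbb{R}^2$ open, $T\subset U_T$ and $f_T\in C^\infty(U_T)$ real-valued; $S(\Delta_v)$ is the set of all such splines. For a multi-index $\alpha$, $D^\alpha$ is the corresponding partial derivative, of order $|\alpha|$. For an integer $r\ge0$, $S^r(\Delta_v)$ is the set of $\sigma\in S(\Delta_v)$ such that $D^\alpha f_{T_1}|_F=D^\alpha f_{T_2}|_F$ for all $|\alpha|\le r$ and all $T_1,T_2\in\Delta_v$ such that $F=T_1\cap T_2$ is an edge. For an integer $\rho\ge0$, $C^\rho(\Delta_v)$ is the set of $\sigma\in S(\Delta_v)$ such that $D^\alpha f_{T_1}(v)=D^\alpha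 f_{T_2}(v)$ for all $|\alpha|\le\rho$ and all $T_1,T_2\in\Delta_v$. The maximal order of supersmoothness is $\operatorname{mos} S^r(\Delta_v)=\max\{\rho\ge r: S^r(\Delta_v)\subset C^\rho(\Delta_v)\}$ ($\rho$ an integer). *)

(* Defs.v *)
(* Real analysis is done over Stdlib's R with Coquelicot; MathComp supplies
   sets, cardinals and nat arithmetic. *)
From Stdlib Require Export Reals.
From Coquelicot Require Export Coquelicot.
From mathcomp Require Export all_boot classical_sets cardinality.

Set Implicit Arguments.
Unset Strict Implicit.
Unset Printing Implicit Defensive.

Local Open Scope classical_set_scope.
Local Open Scope R_scope.

Notation plane := (R * R)%type.

(** ** Points, segments, lines and triangles *)

Definition affine2 (t : R) (a b : plane) : plane :=
  ((1 - t) * a.1 + t * b.1, (1 - t) * a.2 + t * b.2).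

Definition segment (a b : plane) : set plane :=
  [set p | exists2 t : R, 0 <= t <= 1 & p = affine2 t a b].

Definition line_through (a b : plane) : set plane :=
  [set p | exists t : R, p = affine2 t a b].

Definition is_line (L : set plane) : Prop :=
  exists a b : plane, a <> b /\ L = line_through a b.

Definition hull3 (a b c : plane) : set plane :=
  [set p | exists s t u : R,
     [/\ 0 <= s, 0 <= t, 0 <= u, s + t + u = 1 &
         p = (s * a.1 + t * b.1 + u * c.1, s * a.2 + t * b.2 + u * c.2)]].

Definition noncollinear (a b c : plane) : Prop :=
  (b.1 - a.1) * (c.2 - a.2) - (b.2 - a.2) * (c.1 - a.1) <> 0.

(* Triangles are plain point sets; their vertices and edges are recovered from
   the set.  This is unambiguous, since the three corners of a nondegenerate
   triangle are its extreme points. *)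
Definition is_triangle (T : set plane) : Prop :=
  exists a b c : plane, noncollinear a b c /\ T = hull3 a b c.

Definition is_vertex (T : set plane) (p : plane) : Prop :=
  exists b c : plane, noncollinear p b c /\ T = hull3 p b c.

Definition is_edge (T e : set plane) : Prop :=
  exists a b c : plane,
    [/\ noncollinear a b c, T = hull3 a b c & e = segment a b].

(** ** Interior cells *)

Definition common_vertex (T1 T2 : set plane) (p : plane) : Prop :=
  is_vertex T1 p /\ is_vertex T2 p.

Definition common_edge (T1 T2 e : set plane) : Prop :=
  is_edge T1 e /\ is_edge T2 e.

Definition interior_cell (v : plane) (m : nat) (Delta : set (set plane)) :
    Prop :=
  [/\ (Delta #= `I_m)%card,
      forall T, Delta T -> is_triangle T /\ is_vertex T v,
      forall T1 T2, Delta T1 -> Delta T2 -> T1 <> T2 ->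
        (exists p, common_vertex T1 T2 p /\ T1 `&` T2 = [set p])
        \/ common_edge T1 T2 (T1 `&` T2)
    & locally v (\bigcup_(T in Delta) T)].

Definition interior_edge (v : plane) (Delta : set (set plane)) :
    set (set plane) :=
  [set e | e v /\ exists2 T, Delta T & is_edge T e].

(* Slopes are represented by the lines through v carrying interior edges. *)
Definition slopes (v : plane) (Delta : set (set plane)) : set (set plane) :=
  [set L | [/\ is_line L, L v &
               exists2 e, interior_edge v Delta e & e `<=` L]].

(** ** Splines *)

Definition smooth_on (U : set plane) (f : R -> R -> R) : Prop :=
  forall p : plane, U p -> forall n : nat, ex_diff_n f n p.1 p.2.

(* A piece is a pair (U, f).  The function is total, but its values off the
   open set U play no role. *)
Record piece := Piece { dom : set plane; fct : R -> R -> R }.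

(* A family indexed by the triangles of the cell; its values at sets that are
   not triangles of the cell play no role. *)
Definition family := set plane -> piece.

Definition spline (Delta : set (set plane)) : set family :=
  [set sigma | forall T, Delta T ->
     [/\ open (dom (sigma T)), T `<=` dom (sigma T)
       & smooth_on (dom (sigma T)) (fct (sigma T))]].

(* The multi-index is (a, b): a derivatives in x, b derivatives in y. *)
Definition agree_at (k : nat) (f g : R -> R -> R) (p : plane) : Prop :=
  forall a b : nat, (a + b <= k)%N ->
    partial_derive a b f p.1 p.2 = partial_derive a b g p.1 p.2.

Definition smooth_spline (r : nat) (Delta : set (set plane)) : set family :=
  [set sigma | spline Delta sigma /\
     forall T1 T2, Delta T1 -> Delta T2 -> common_edge T1 T2 (T1 `&` T2) ->
       forall p, (T1 `&` T2) p -> agree_at r (fct (sigma T1)) (fct (sigma T2)) p].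

Definition smooth_at_vertex (rho : nat) (v : plane) (Delta : set (set plane)) :
    set family :=
  [set sigma | spline Delta sigma /\
     forall T1 T2, Delta T1 -> Delta T2 ->
       agree_at rho (fct (sigma T1)) (fct (sigma T2)) v].

Definition supersmoothness_orders (r : nat) (v : plane)
    (Delta : set (set plane)) : set nat :=
  [set rho : nat | (r <= rho)%N /\
     smooth_spline r Delta `<=` smooth_at_vertex rho v Delta].

(* [is_mos r v Delta k] states that the maximum exists and equals k. *)
Definition is_mos (r : nat) (v : plane) (Delta : set (set plane)) (k : nat) :
    Prop :=
  supersmoothness_orders r v Delta k /\
  forall rho, supersmoothness_orders r v Delta rho -> (rho <= k)%N.

(* Main.v *)
Require Import Defs.
From mathcomp Require Import all_algebra Rstruct boolp zify.
From Stdlib Require Import Lra.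

(** Fix the vertex v, and let an edge of direction p separate two pieces of a
    C^r spline.  Their derivatives of order at most r agree on the edge, so they
    still agree there after any number of differentiations along p.  Binary
    forms of degree d act on jets at v as homogeneous differential operators of
    order d = r + e, and the jump of the spline across the edge becomes a linear
    functional on these forms that kills every multiple of L^e, where L is the
    linear form of the derivative along p ([pairing_agree]).  Going once around
    v, the jumps add up to zero.

    When the lines of the edges are distinct and m e <= d + 1, every form of
    degree d is the sum of a multiple of L_i^e and of a multiple of the product
    of the other L_j^e ([form_split]).  The jump at edge i kills the first
    summand; it is minus the sum of the other jumps, which kill the second.  So
    all jumps vanish ([jets_vanish]).  The condition m (d - r) <= d + 1 says
    (m - 1) (d - r) <= r + 1, which gives the lower bound on the order of
    supersmoothness ([spline_jets_agree]).

    Conversely let l_i be the linear form vanishing on edge i.  A syzygy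
    sum_i l_i^(r+1) q_i = 0 with forms q_i of degree k, not all zero, is the
    family of jumps of a piecewise polynomial C^r spline that is not smooth of
    order r + 1 + k at v ([syzygy_bounds_order]).  Such syzygies exist as soon
    as the m (k + 1) coefficients outnumber the r + k + 2 coefficients of a form
    of degree r + 1 + k ([syzygy_exists]), that is, for
    k = (r + 1) / (m - 1) rounded down.  If two edges lie on one line, there is
    one with k = 0.

    All this needs the combinatorial shape of a cell: the triangles form one
    cycle around v ([cell_fan]), each sharing an edge with its successor.  The
    successor exists because the triangles cover a neighbourhood of v; there is
    only one cycle because two distinct cycles would split the punctured plane
    into two closed cones with no common point, against connectedness
    ([orbit_full]). *)

Set Implicit Arguments.
Unset Strict Implicit.
Unset Printing Implicit Defensive.

Local Open Scope classical_set_scope.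
Local Open Scope R_scope.

(** * Binary forms and their syzygies *)

Section Forms.
Import GRing.Theory.
Local Open Scope ring_scope.
Variable K : fieldType.
Implicit Types (P Q s t : {poly K}) (a b c : K * K) (d e k : nat).

(** Binary forms of degree d are dehomogenised: the coefficient of 'X^j stands
    for the monomial x^(d-j) y^j, so a form of degree d is a polynomial of size
    at most d.+1, and its degree is carried separately.  In particular
    [lform a] may be a constant when seen as a polynomial. *)
Definition lform a : {poly K} := a.1%:P + a.2 *: 'X.

Definition det2 a b : K := a.1 * b.2 - a.2 * b.1.

(** The value of a form of degree d when x^a y^b is replaced by [A a b].  With
    A the array of partial derivatives at a point, the form acts as a
    differential operator; with A the powers of two numbers, it is evaluated. *)
Definition pairing d P (A : nat -> nat -> K) : K :=
  \sum_(j < d.+1) P`_j * A (d - j)%N j.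

Lemma lform_monic a :
  a.2 != 0 -> lform a = a.2 *: ('X - (- (a.1 / a.2))%:P).
Proof.
move=> a2; rewrite polyCN opprK scalerDr -[_ *: _%:P]mul_polyC -polyCM.
by rewrite mulrCA divff // mulr1 addrC.
Qed.

Lemma size_lformM a P n : (size P <= n)%N -> (size (lform a * P)%R <= n.+1)%N.
Proof.
move=> sP; rewrite mulrDl mul_polyC -scalerAl.
apply: leq_trans (size_polyD _ _) _; rewrite geq_max.
rewrite (leq_trans (size_scale_leq _ _)) ?(leq_trans sP) //.
apply: leq_trans (size_scale_leq _ _) _.
by rewrite mulrC (leq_trans (size_polyMleq _ _)) // size_polyX addn2.
Qed.

Lemma size_lformXM a e P n :
  (size P <= n)%N -> (size (lform a ^+ e * P)%R <= e + n)%N.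
Proof.
by elim: e => [|e IH] sP; rewrite ?mul1r // exprS -mulrA; apply/size_lformM/IH.
Qed.

Lemma size_lformX a e : (size (lform a ^+ e)%R <= e.+1)%N.
Proof. by rewrite -[lform a ^+ e]mulr1 -addn1 size_lformXM // size_poly1. Qed.

Lemma size_prod_lformM (S : seq (K * K)) P n : (size P <= n)%N ->
  (size (\prod_(a <- S) lform a * P)%R <= size S + n)%N.
Proof.
elim: S => [|a S IH] sP; rewrite ?big_nil ?mul1r // big_cons -mulrA.
exact/size_lformM/IH.
Qed.

(** Modulo [lform b], a form is determined by its value at the zero of [lform b]
    on the projective line, and [lform a], not being proportional, does not
    vanish there. *)
Lemma form_mod_lform a b n t : det2 a b != 0 -> (size t <= n.+1)%N ->
  exists (c : K) t', t = c *: lform a ^+ n + lform b * t' /\ (size t' <= n)%N.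
Proof.
case: a b => a1 a2 [b1 b2]; rewrite /det2 /= => nab st.
(* If b2 = 0, the zero of the form is at infinity, where the value of a form
   is its top coefficient. *)
have [b20|b2n0] := eqVneq b2 0.
  have b1n0 : b1 != 0 by apply: contraNneq nab => ->; rewrite b20 !mulr0 subrr.
  have a2n0 : a2 != 0.
    by apply: contraNneq nab => ->; rewrite b20 mulr0 mul0r subrr.
  have lb : lform (b1, b2) = b1%:P by rewrite /lform b20 scale0r addr0.
  pose q := t - (t`_n / a2 ^+ n) *: lform (a1, a2) ^+ n.
  exists (t`_n / a2 ^+ n), (b1^-1 *: q); split.
    by rewrite lb mul_polyC scalerA divff // scale1r addrC subrK.
  apply: leq_trans (size_scale_leq _ _) _.
  have coefL : (lform (a1, a2) ^+ n)`_n = a2 ^+ n.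
    rewrite lform_monic // exprZn coefZ.
    have /monicP := monic_exp n (monicXsubC (- (a1 / a2))).
    by rewrite lead_coefE size_exp_XsubC /= => ->; rewrite mulr1.
  have sq : (size q <= n.+1)%N.
    apply: leq_trans (size_polyD _ _) _; rewrite geq_max st size_polyN /=.
    exact: leq_trans (size_scale_leq _ _) (size_lformX _ _).
  apply/leq_sizeP => j; rewrite leq_eqVlt => /predU1P[<-|ltnj].
    by rewrite coefB coefZ coefL mulfVK ?subrr // expf_neq0.
  by move/leq_sizeP: sq => ->.
pose x := - (b1 / b2); pose La := a1 + a2 * x.
have La0 : La != 0.
  rewrite /La /x.
  apply: contraNneq nab => /(congr1 ( *%R^~ b2)).
  rewrite mul0r mulrDl mulrN mulNr -mulrA mulfVK // => <-.
  by [].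
pose q := t - (t.[x] / La ^+ n) *: lform (a1, a2) ^+ n.
have /factor_theorem [u qu] : root q x.
  by rewrite /root !hornerE /= -/La mulfVK ?subrr // expf_neq0.
exists (t.[x] / La ^+ n), (b2^-1 *: u).
have lb : lform (b1, b2) = b2 *: ('X - x%:P) by rewrite lform_monic.
split.
  rewrite lb -scalerAl -scalerAr scalerA divff // scale1r [(_ - _) * u]mulrC -qu.
  by rewrite addrC subrK.
apply: leq_trans (size_scale_leq _ _) _.
have sq : (size q <= n.+1)%N.
  apply: leq_trans (size_polyD _ _) _; rewrite geq_max st size_polyN /=.
  exact: leq_trans (size_scale_leq _ _) (size_lformX _ _).
have [->|un0] := eqVneq u 0; first by rewrite size_poly0.
by move: sq; rewrite qu size_Mmonic ?monicXsubC // size_XsubC addn2.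
Qed.

(** A Bezout identity with degree bounds: L^e and a product of f linear forms
    prime to L generate all forms whose number N of coefficients is at least
    e + f.  When a factor M joins the product, the cofactor t of the old product
    is replaced modulo M by a multiple of a power of L which is at least e, and
    that term moves to the multiples of L^e. *)
Lemma form_split a (S : seq (K * K)) e N P :
  (forall b, b \in S -> det2 a b != 0) ->
  (e + size S <= N)%N -> (size P <= N)%N ->
  exists s t, [/\ P = lform a ^+ e * s + \prod_(b <- S) lform b * t,
    (size s <= N - e)%N & (size t <= N - size S)%N].
Proof.
move=> + + sP; elim: S => [|b S IH] nS leN.
  exists 0, P; rewrite big_nil mulr0 add0r mul1r size_poly0 subn0.
  by split.
have [|/=|s [t [-> ss st]]] := IH; first by move=> c cS; apply: nS; rewrite inE cS orbT.
  by move: leN => /=; lia.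
have [||c [t' [-> st']]] := @form_mod_lform a b (N - (size S).+1) t.
- by apply: nS; rewrite mem_head.
- by move: leN st => /=; lia.
exists (s + lform a ^+ (N - (size S).+1 - e) * (\prod_(b <- S) lform b * c%:P)), t'.
split=> //.
  have {1}-> : (N - (size S).+1 = e + (N - (size S).+1 - e))%N.
    by move: leN => /=; lia.
  rewrite big_cons exprD -mul_polyC !mulrDr -addrA; congr (_ + (_ + _)).
    by rewrite mulrA [RHS]mulrA [LHS]mulrC.
  by rewrite mulrCA mulrA.
apply: leq_trans (size_polyD _ _) _; rewrite geq_max ss /=.
apply: leq_trans (size_lformXM _ _ (size_prod_lformM _ (size_polyC_leq1 c))) _.
by move: leN => /=; lia.
Qed.

Lemma pairingD d P Q A : pairing d (P + Q) A = pairing d P A + pairing d Q A.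
Proof. by rewrite -big_split; apply: eq_bigr => j _; rewrite coefD mulrDl. Qed.

Lemma pairing_sumr (I : finType) d P (J : I -> nat -> nat -> K) :
  \sum_i pairing d P (J i) = pairing d P (fun x y => \sum_i J i x y).
Proof. by rewrite exchange_big; apply: eq_bigr => j _; rewrite mulr_sumr. Qed.

Lemma pairingXn d (b : nat) A : (b <= d)%N -> pairing d 'X^b A = A (d - b)%N b.
Proof.
move=> bd; rewrite /pairing (bigD1 (inord b)) //= inordK // coefXn eqxx mul1r.
rewrite big1 ?addr0 // => j jb; rewrite coefXn.
by case: eqP => [jE|_]; [rewrite -jE inord_val eqxx in jb|rewrite mul0r].
Qed.

(** Multiplication by a linear form is dual to shifting the array: for arrays of
    derivatives this is differentiation along a, for arrays of powers it is
    multiplication by the value of the linear form. *)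
Lemma pairing_lform d a P A : (size P <= d.+1)%N ->
  pairing d.+1 (lform a * P) A =
  a.1 * pairing d P (fun x y => A x.+1 y) + a.2 * pairing d P (fun x y => A x y.+1).
Proof.
move=> /leq_sizeP sP; rewrite /pairing.
have coefL j : (lform a * P)`_j = a.1 * P`_j + a.2 * (if j is i.+1 then P`_i else 0).
  rewrite mulrDl coefD coefCM -scalerAl coefZ coefXM.
  by case: j.
under eq_bigr do rewrite coefL mulrDl.
rewrite big_split /=; congr (_ + _).
  rewrite big_ord_recr /= sP // mulr0 mul0r addr0 mulr_sumr.
  by apply: eq_bigr => j _; rewrite -mulrA subSn // -ltnS.
rewrite big_ord_recl /= mulr0 mul0r add0r mulr_sumr.
by apply: eq_bigr => j _; rewrite -mulrA.
Qed.

Section Syzygies.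
Variables (I : finType) (a : I -> K * K) (e : nat).

Let lines (A : {pred I}) : seq (K * K) := flatten [seq nseq e (a j) | j <- enum A].

Let prod_lines A : \prod_(b <- lines A) lform b = \prod_(j in A) lform (a j) ^+ e.
Proof.
rewrite big_flatten big_map big_enum /=; apply: eq_bigr => j _.
by rewrite big_nseq iter_mulr_1.
Qed.

Let size_lines A : size (lines A) = (#|A| * e)%N.
Proof.
rewrite size_flatten /shape -map_comp (@eq_map _ _ _ (fun=> e)); last first.
  by move=> j /=; rewrite size_nseq.
by rewrite sumnE big_map big_enum /= sum_nat_const.
Qed.

(** Each J i kills the multiples of its own power; being minus the sum of the
    other J j, it also kills the common multiples of all other powers.  By
    [form_split] these two kinds of forms span. *)
Lemma jets_vanish d (J : I -> nat -> nat -> K) :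
  {in [pred ij : I * I | ij.1 != ij.2], forall ij, det2 (a ij.1) (a ij.2) != 0} ->
  (#|I| * e <= d.+1)%N ->
  (forall x y, \sum_i J i x y = 0) ->
  (forall i s, (size s <= d.+1 - e)%N -> pairing d (lform (a i) ^+ e * s) (J i) = 0) ->
  forall i P, (size P <= d.+1)%N -> pairing d P (J i) = 0.
Proof.
move=> na le_d sumJ Jker i P sP.
have cI : #|I| = (#|predC1 i|).+1 by rewrite cardC1 prednK //; apply/card_gt0P; exists i.
have [|||s [t [-> ss st]]] := @form_split (a i) (lines (predC1 i)) e d.+1 P.
- move=> b /flattenP[_ /mapP[j + ->]]; rewrite mem_enum inE => ji.
  by rewrite mem_nseq => /andP[_ /eqP->]; apply: (na (i, j)); rewrite inE /= eq_sym.
- by rewrite size_lines; move: le_d; rewrite cI mulSn.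
- exact: sP.
rewrite pairingD Jker // add0r prod_lines.
set B := _ * t.
have : \sum_j pairing d B (J j) = 0.
  rewrite pairing_sumr /pairing big1 // => j _; by rewrite sumJ mulr0.
rewrite (bigD1 i) //= big1 ?addr0 // => j ji.
rewrite /B (bigD1 j) //= -mulrA; apply: Jker.
rewrite (eq_bigl [in [predD1 predC1 i & j]]) => [|x]; last by rewrite !inE andbC.
rewrite -prod_lines.
apply: leq_trans (size_prod_lformM _ st) _.
rewrite !size_lines; move: le_d.
rewrite cI [in X in (X <= _)%N](cardD1 j) [in X in (_ - X)%N](cardD1 j) !inE ji.
by rewrite !(add1n, mulSn); move: (_ * e)%N => c; lia.
Qed.

(** The |I| (k+1) unknown coefficients of the Q i outnumber the e + k + 1
    equations, so the matrix of the linear system has a nonzero left kernel. *)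
Lemma syzygy_exists k : (e + k.+1 < #|I| * k.+1)%N ->
  exists Q : I -> {poly K}, [/\ forall i, (size (Q i) <= k.+1)%N,
    \sum_i lform (a i) ^+ e * Q i = 0 & exists i, Q i != 0].
Proof.
move=> lt_k.
pose U : finType := (I * 'I_k.+1)%type.
pose ev (u : 'I_#|U|) : I * 'I_k.+1 := enum_val u.
pose M : 'M[K]_(#|U|, e + k.+1) :=
  \matrix_(u, v) (lform (a (ev u).1) ^+ e * 'X^((ev u).2))`_v.
have : kermx M != 0.
  rewrite kermx_eq0 /row_free neq_ltn; apply/orP; left.
  by apply: leq_ltn_trans (rank_leq_col M) _; rewrite card_prod card_ord.
move=> /rowV0Pn[w /sub_kermxP wM w0].
pose c i j := w 0 (enum_rank ((i, j) : U)).
pose Q i := \sum_(j < k.+1) c i j *: 'X^j : {poly K}.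
have Qc i (j : 'I_k.+1) : (Q i)`_j = c i j.
  rewrite coef_sum (bigD1 j) //= coefZ coefXn eqxx mulr1 big1 ?addr0 // => l lj.
  by rewrite coefZ coefXn -[_ == _]/(j == l) eq_sym (negbTE lj) mulr0.
have sQ i : (size (Q i) <= k.+1)%N.
  apply/(leq_trans (size_sum _ _ _))/bigmax_leqP => j _.
  by rewrite (leq_trans (size_scale_leq _ _)) // size_polyXn.
exists Q; split=> //.
  apply/polyP => v; rewrite coef0.
  have [lt_v|le_v] := ltnP v (e + k.+1); last first.
    apply: (leq_sizeP _ _ _) le_v.
    apply/(leq_trans (size_sum _ _ _))/bigmax_leqP => i _.
    exact: size_lformXM.
  have := congr1 (fun N : 'rV_ _ => N 0 (Ordinal lt_v)) wM.
  rewrite !mxE; apply: etrans; rewrite coef_sum.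
  under eq_bigr => i _ do rewrite mulr_sumr coef_sum.
  rewrite pair_bigA /= [RHS](reindex (@enum_rank U)) /=; last first.
    by apply: onW_bij; apply: enum_rank_bij.
  apply: eq_bigr => -[i j] _; rewrite !mxE /ev enum_rankK /= /c.
  by rewrite -scalerAr coefZ.
have [u wu] : exists u, w 0 u != 0.
  apply/existsP; apply: contra_neqT w0 => /existsPn w0; apply/rowP => u.
  by rewrite mxE; apply/eqP/negPn/w0.
exists (ev u).1; apply: contraNneq wu => Q0.
have := Qc (ev u).1 (ev u).2; rewrite Q0 coef0 /c -surjective_pairing.
by rewrite enum_valK => <-.
Qed.

(** Powers of proportional linear forms are proportional. *)
Lemma proportional_syzygy i j (t : K) : i != j -> lform (a j) = t *: lform (a i) ->
  exists Q : I -> {poly K}, [/\ forall l, (size (Q l) <= 1)%N,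
    \sum_l lform (a l) ^+ e * Q l = 0 & exists l, Q l != 0].
Proof.
move=> ij aij.
exists (fun l => if l == i then (t ^+ e)%:P else if l == j then -1 else 0); split.
- move=> l; case: ifP => _; first exact: size_polyC_leq1.
  by case: ifP => _; rewrite ?size_polyN ?size_poly1 ?size_poly0.
- rewrite (bigD1 i) //= (bigD1 j) 1?eq_sym //= big1 ?addr0 => [|l /andP[li lj]].
    rewrite eqxx [j == i]eq_sym (negbTE ij) eqxx aij.
    by rewrite exprZn mulrC mul_polyC mulrN1 subrr.
  by rewrite (negbTE li) (negbTE lj) mulr0.
- by exists j; rewrite [j == i]eq_sym (negbTE ij) eqxx oppr_eq0 oner_eq0.
Qed.

End Syzygies.
End Forms.

Section Potential.
Import GRing.Theory.
Local Open Scope ring_scope.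

(** Jumps around a cycle that add up to zero are the differences of a function
    on the cycle: sum them from a base point. *)
Lemma cyclic_potential (I : finType) (V : zmodType) (s : I -> I) (G : I -> V) :
  injective s -> (forall i j, fconnect s i j) -> \sum_i G i = 0 ->
  exists F : I -> V, forall i, F (s i) = F i + G (s i).
Proof.
move=> s_inj conn sumG.
have [i0 _|I0] := pickP (@predT I); last by exists (fun=> 0) => i; have := I0 i.
pose n i := findex s i0 i.
exists (fun i => \sum_(j < (n i).+1) G (iter j s i0)) => i.
have iE : iter (n i) s i0 = i by rewrite iter_findex.
have siE : iter (n i).+1 s i0 = s i by rewrite iterS iE.
have := findex_max (conn i0 i); rewrite -/(n i) leq_eqVlt => /predU1P[nE|lt_n].
  have si0 : s i = i0 by rewrite -siE nE iter_order.
  have n0 : n (s i) = 0%N by rewrite si0 /n findex0.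
  rewrite n0 big_ord1 /= si0 -[LHS]add0r; congr (_ + _).
  apply/esym; apply: etrans sumG; rewrite nE.
  rewrite [RHS](eq_bigl [in orbit s i0]) => [|x]; last by rewrite -fconnect_orbit conn.
  rewrite -big_uniq ?orbit_uniq //= /orbit.
  rewrite (big_nth i0) size_traject big_mkord.
  by apply: eq_bigr => j _; rewrite nth_traject.
have -> : n (s i) = (n i).+1 by rewrite -siE /n findex_iter.
by rewrite big_ord_recr /= iE.
Qed.
End Potential.

(** * Jets of pieces that agree along an edge *)

Section Jets.
Import GRing.Theory.

Definition jet (f : R -> R -> R) (p : plane) (a b : nat) : R :=
  partial_derive a b f p.1 p.2.

Definition along (v u : plane) (t : R) : plane := (v.1 + t * u.1, v.2 + t * u.2).

Lemma open_locally_2d (U : set plane) (p : plane) (P : R -> R -> Prop) :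
  open U -> U p -> (forall q, U q -> P q.1 q.2) -> locally_2d P p.1 p.2.
Proof.
move=> oU Up UP; apply/locally_2d_locally.
by rewrite -surjective_pairing; apply: filter_imp (oU p Up) => q /UP.
Qed.

(** Continuous partial derivatives give the total derivative that the chain rule
    along a line needs. *)
Lemma smooth_differentiable (U : set plane) f (p : plane) :
  open U -> smooth_on U f -> U p ->
  differentiable_pt_lim f p.1 p.2 (Derive (fun z => f z p.2) p.1)
    (Derive (fun z => f p.1 z) p.2).
Proof.
move=> oU sf Up; apply/filterdiff_differentiable_pt_lim.
apply: (@is_derive_filterdiff f p.1 p.2 (fun x y => Derive (fun z => f z y) x)).
- rewrite -surjective_pairing; apply: filter_imp (oU p Up) => q Uq.
  by apply: Derive_correct; have [_ []] := sf q Uq 1%N.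
- by apply: Derive_correct; have [_ [_ []]] := sf p Up 1%N.
- apply: (proj1 (continuity_2d_pt_filterlim (fun x y => Derive (fun z => f z y) x) _ _)).
  by have [_ [_ [_ [[]]]]] := sf p Up 1%N.
Qed.

Lemma smooth_partial (U : set plane) f a b :
  smooth_on U f -> smooth_on U (partial_derive a b f).
Proof.
move=> sf p Up n.
have := @ex_diff_n_deriv (n + (a + b))%coq_nat a b _ f _ _ (sf p Up _).
rewrite (_ : Nat.sub _ _ = n); last by lia.
by apply; lia.
Qed.

(** Schwarz: a derivative in y taken last can be moved inside the derivatives in
    x. *)
Lemma partial_Dy (U : set plane) f a b (p : plane) :
  open U -> smooth_on U f -> U p ->
  Derive (fun z => partial_derive a b f p.1 z) p.2 = jet f p a b.+1.
Proof.
move=> oU sf Up; apply: Derive_partial_derive.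
by apply: (open_locally_2d oU Up) => q Uq; apply: sf.
Qed.

Lemma is_derive_jet (U : set plane) f a b v u t :
  open U -> smooth_on U f -> U (along v u t) ->
  is_derive (fun t => jet f (along v u t) a b) t
    (u.1 * jet f (along v u t) a.+1 b + u.2 * jet f (along v u t) a b.+1).
Proof.
move=> oU sf Ut; apply/is_derive_Reals.
have dl : forall x c : R, derivable_pt_lim (fun t => x + t * c) t c.
  move=> x c; apply/is_derive_Reals; auto_derive => //; ring.
have := derivable_pt_lim_comp_2d (partial_derive a b f)
  (fun t => v.1 + t * u.1) (fun t => v.2 + t * u.2) t _ _ _ _
  (smooth_differentiable oU (smooth_partial a b sf) Ut)
  (dl v.1 u.1) (dl v.2 u.2).
rewrite (partial_Dy a b oU sf Ut).
set l1 := _ + _; set l2 := _ + _; suff -> : l1 = l2 by [].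
by rewrite /l1 /l2 Rmult_comm [X in _ + X]Rmult_comm.
Qed.

Lemma is_derive_bigsum n (F : 'I_n -> R -> R) (F' : 'I_n -> R) t :
  (forall j, is_derive (F j) t (F' j)) ->
  is_derive (fun t => \sum_j F j t)%R t (\sum_j F' j)%R.
Proof.
elim: n F F' => [|n IH] F F' dF.
  rewrite big_ord0; apply: (is_derive_ext (fun=> 0)) => [x|].
    by rewrite big_ord0.
  exact: is_derive_const.
rewrite big_ord_recr /=.
apply: (is_derive_ext (fun x =>
  plus (\sum_(j < n) F (widen_ord (leqnSn n) j) x)%R (F ord_max x))).
  by move=> x; rewrite big_ord_recr.
by apply: is_derive_plus; [exact: IH|exact: dF].
Qed.

(** Differentiating along u amounts to multiplying the operator by the linear
    form of u. *)
Lemma is_derive_pairing (U : set plane) f (d : nat) (P : {poly R}) v u t :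
  open U -> smooth_on U f -> U (along v u t) -> (size P <= d.+1)%N ->
  is_derive (fun t => pairing d P (jet f (along v u t))) t
    (pairing d.+1 (lform u * P)%R (jet f (along v u t))).
Proof.
move=> oU sf Ut sP; rewrite pairing_lform // /pairing !mulr_sumr -big_split /=.
apply: is_derive_bigsum => j.
set D := (_ + _)%R.
have -> : D = scal (P`_j)%R (u.1 * jet f (along v u t) (d - j).+1 j
                            + u.2 * jet f (along v u t) (d - j) j.+1).
  rewrite /D mulrCA [X in (_ + X)%R]mulrCA -mulrDr.
  by rewrite RmultE.
apply: is_derive_scal.
exact: (is_derive_jet _ _ oU sf Ut).
Qed.

(** Two functions that agree on the open segment have the same derivative along
    it; each such derivative adds a factor [lform u]. *)
Lemma pairing_agree_interior (U : set plane) f g c n (P : {poly R}) v u :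
  open U -> smooth_on U f -> smooth_on U g ->
  (forall t, 0 < t < 1 -> U (along v u t) /\ agree_at c f g (along v u t)) ->
  (size P <= c.+1)%N -> forall t, 0 < t < 1 ->
  pairing (n + c) (lform u ^+ n * P)%R (jet f (along v u t)) =
  pairing (n + c) (lform u ^+ n * P)%R (jet g (along v u t)).
Proof.
move=> oU sf sg fg sP; elim: n => [|n IH] t t01.
  have [_ ag] := fg t t01.
  apply: eq_bigr => j _; congr (_ * _)%R; apply: ag.
  by rewrite subnK // -ltnS.
have sPn : (size (lform u ^+ n * P)%R <= (n + c).+1)%N.
  by rewrite -addnS; apply: size_lformXM.
have [Ut _] := fg t t01.
rewrite exprS -mulrA.
have d1 := is_derive_pairing oU sf Ut sPn.
have d2 := is_derive_pairing oU sg Ut sPn.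
rewrite -(is_derive_unique _ _ _ d1) -(is_derive_unique _ _ _ d2).
apply: Derive_ext_loc.
have e0 : 0 < Rmin t (1 - t) by apply: Rmin_glb_lt; lra.
exists (mkposreal _ e0) => s /Rabs_lt_between.
have := Rmin_l t (1 - t); have := Rmin_r t (1 - t).
rewrite /minus /plus /Hierarchy.opp /= => *; apply: IH; lra.
Qed.

(** The vertex is an end point of the edge, so the equality on the open segment
    is carried to it by continuity. *)
Lemma pairing_agree (U : set plane) f g c n (P : {poly R}) v u :
  open U -> smooth_on U f -> smooth_on U g -> U v ->
  (forall t, 0 < t < 1 -> U (along v u t) /\ agree_at c f g (along v u t)) ->
  (size P <= c.+1)%N ->
  pairing (n + c) (lform u ^+ n * P)%R (jet f v) =
  pairing (n + c) (lform u ^+ n * P)%R (jet g v).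
Proof.
move=> oU sf sg Uv fg sP.
have v0 : along v u 0 = v.
  by rewrite /along !Rmult_0_l !Rplus_0_r -surjective_pairing.
have sPn : (size (lform u ^+ n * P)%R <= (n + c).+1)%N.
  by rewrite -addnS; apply: size_lformXM.
have U0 : U (along v u 0) by rewrite v0.
have d1 := is_derive_pairing oU sf U0 sPn.
have d2 := is_derive_pairing oU sg U0 sPn.
have c0 := ex_derive_continuous _ _ (ex_intro _ _ (is_derive_minus _ _ _ _ _ d1 d2)).
pose h t := minus (pairing (n + c) (lform u ^+ n * P)%R (jet f (along v u t)))
   (pairing (n + c) (lform u ^+ n * P)%R (jet g (along v u t))).
have h0 t : 0 < t < 1 -> h t = 0.
  move=> t01; rewrite /h (pairing_agree_interior n oU sf sg fg sP t01).
  exact: minus_eq_zero.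
suff : h 0 = 0.
  by rewrite /h v0 /minus /plus /Hierarchy.opp /= => /Rminus_diag_uniq.
have [//|hn0] := Req_dec (h 0) 0.
have [e He] := proj1 (filterlim_locally _ _) c0 (mkposreal _ (Rabs_pos_lt _ hn0)).
pose t := Rmin (e / 2) (1 / 2).
have e0 := cond_pos e.
have t0 : 0 < t by apply: Rmin_glb_lt; lra.
have te : t <= e / 2 by apply: Rmin_l.
have t1 : t <= 1 / 2 by apply: Rmin_r.
have : ball 0 e t.
  rewrite /ball /= /AbsRing_ball /abs /minus /plus /Hierarchy.opp /=.
  by rewrite Ropp_0 Rplus_0_r Rabs_pos_eq; lra.
move/He; rewrite -/(h t) (h0 t (conj t0 _)); last lra.
rewrite /ball /= /AbsRing_ball /abs -/(h 0) /minus /plus /Hierarchy.opp /=.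
by rewrite [X in Rabs X]Rplus_0_l Rabs_Ropp => /Rlt_irrefl.
Qed.

End Jets.

(** * Polynomial functions and homogeneous pieces *)

Section PolynomialPieces.
Import GRing.Theory.

(** A class that contains the pieces of the constructed splines, closed under
    both partial derivatives, so that smoothness and the vanishing of
    derivatives follow by induction. *)
Inductive polyfun : (R -> R -> R) -> Prop :=
| polyfun_const c : polyfun (fun _ _ => c)
| polyfun_x : polyfun (fun x _ => x)
| polyfun_y : polyfun (fun _ y => y)
| polyfun_add f g : polyfun f -> polyfun g -> polyfun (fun x y => f x y + g x y)
| polyfun_mul f g : polyfun f -> polyfun g -> polyfun (fun x y => f x y * g x y).

Lemma polyfun_is_derive f : polyfun f -> exists fx fy,
  [/\ polyfun fx, polyfun fy, forall x y, is_derive (fun z => f z y) x (fx x y)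
    & forall x y, is_derive (fun z => f x z) y (fy x y)].
Proof.
elim=> [c|||{}f g _ [fx [fy [pfx pfy dfx dfy]]] _ [gx [gy [pgx pgy dgx dgy]]]
  |{}f g pf [fx [fy [pfx pfy dfx dfy]]] pg [gx [gy [pgx pgy dgx dgy]]]].
- exists (fun _ _ => 0), (fun _ _ => 0).
  by split; try exact: polyfun_const; move=> x y; apply: is_derive_const.
- exists (fun _ _ => 1), (fun _ _ => 0); split; try exact: polyfun_const.
    by move=> x y; apply: is_derive_id.
  by move=> x y; apply: is_derive_const.
- exists (fun _ _ => 0), (fun _ _ => 1); split; try exact: polyfun_const.
    by move=> x y; apply: is_derive_const.
  by move=> x y; apply: is_derive_id.
- exists (fun x y => fx x y + gx x y), (fun x y => fy x y + gy x y).
  by split; try exact: polyfun_add; move=> x y; apply: is_derive_plus.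
- exists (fun x y => fx x y * g x y + f x y * gx x y),
    (fun x y => fy x y * g x y + f x y * gy x y).
  split; try (by apply: polyfun_add; apply: polyfun_mul);
    by move=> x y; apply: is_derive_mult => //; apply: Rmult_comm.
Qed.

Lemma polyfun_Dx f : polyfun f -> polyfun (fun x y => Derive (fun z => f z y) x).
Proof.
move=> /polyfun_is_derive[fx [_ [pfx _ dfx _]]].
rewrite (_ : (fun x y => _) = fx) //.
by apply/funext => x; apply/funext => y; apply: is_derive_unique.
Qed.

Lemma polyfun_Dy f : polyfun f -> polyfun (fun x y => Derive (fun z => f x z) y).
Proof.
move=> /polyfun_is_derive[_ [fy [_ pfy _ dfy]]].
rewrite (_ : (fun x y => _) = fy) //.
by apply/funext => x; apply/funext => y; apply: is_derive_unique.
Qed.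

Lemma polyfun_continuity f x y : polyfun f -> continuity_2d_pt f x y.
Proof.
elim=> [c|||{}f g _ cf _ cg|{}f g _ cf _ cg].
- exact: continuity_2d_pt_const.
- exact: continuity_2d_pt_id1.
- exact: continuity_2d_pt_id2.
- exact: continuity_2d_pt_plus.
- exact: continuity_2d_pt_mult.
Qed.

Lemma polyfun_ex_derive f x y : polyfun f ->
  ex_derive (fun z => f z y) x /\ ex_derive (fun z => f x z) y.
Proof.
by move=> /polyfun_is_derive[fx [fy [_ _ dfx dfy]]]; split; eexists; eauto.
Qed.

Lemma polyfun_smooth U f : polyfun f -> smooth_on U f.
Proof.
move=> pf p _ n; elim: n f pf => [|n IH] f pf; split=> //;
  try exact: polyfun_continuity.
have [dx dy] := polyfun_ex_derive p.1 p.2 pf.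
by split=> //; split=> //; split; apply: IH; [apply: polyfun_Dx|apply: polyfun_Dy].
Qed.

Lemma partial_add f g a b : polyfun f -> polyfun g ->
  partial_derive a b (fun x y => f x y + g x y) =
  (fun x y => partial_derive a b f x y + partial_derive a b g x y) /\
  (polyfun (partial_derive a b f) /\ polyfun (partial_derive a b g)).
Proof.
move=> pf pg; elim: a => [|a [IH [pfa pga]]].
  elim: b => [|b [IH [pfb pgb]]]; first by [].
  split; last by split; apply: (polyfun_Dy (f := partial_derive 0 b _)).
  apply/funext => x; apply/funext => y.
  rewrite -[LHS]/(Derive (fun z => partial_derive 0 b (fun x y => f x y + g x y) x z) y).
  have [_ d1] := polyfun_ex_derive x y pfb; have [_ d2] := polyfun_ex_derive x y pgb.
  by rewrite IH Derive_plus.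
split; last by split; apply: (polyfun_Dx (f := partial_derive a b _)).
apply/funext => x; apply/funext => y.
rewrite -[LHS]/(Derive (fun z => partial_derive a b (fun x y => f x y + g x y) z y) x).
have [d1 _] := polyfun_ex_derive x y pfa; have [d2 _] := polyfun_ex_derive x y pga.
by rewrite IH Derive_plus.
Qed.

Section Vanishing.
Variables (l : R -> R -> R) (lx ly : R).
Hypotheses (pl : polyfun l) (dlx : forall x y, is_derive (fun z => l z y) x lx)
  (dly : forall x y, is_derive (fun z => l x z) y ly).

Definition divisible_by n f :=
  exists2 q, polyfun q & f = (fun x y => l x y ^ n * q x y).

(** A derivative of l^(n+1) q is l^n times a polynomial function, so that each
    differentiation costs one factor l. *)
Lemma divisible_Dx n f : divisible_by n.+1 f ->
  divisible_by n (fun x y => Derive (fun z => f z y) x).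
Proof.
move=> [q pq ->]; have [qx [_ [pqx _ dqx _]]] := polyfun_is_derive pq.
exists (fun x y => (INR n.+1 * lx) * q x y + l x y * qx x y).
  by do ?[apply: polyfun_add|apply: polyfun_mul|apply: polyfun_const].
apply/funext => x; apply/funext => y; apply: is_derive_unique.
have := is_derive_mult _ _ x _ _ (is_derive_pow _ n.+1 _ _ (dlx x y)) (dqx x y) Rmult_comm.
set D := plus _ _; suff -> : D = l x y ^ n * (INR n.+1 * lx * q x y + l x y * qx x y) by [].
by rewrite /D /plus /mult /= -/(INR n.+1); ring.
Qed.

Lemma divisible_Dy n f : divisible_by n.+1 f ->
  divisible_by n (fun x y => Derive (fun z => f x z) y).
Proof.
move=> [q pq ->]; have [_ [qy [_ pqy _ dqy]]] := polyfun_is_derive pq.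
exists (fun x y => (INR n.+1 * ly) * q x y + l x y * qy x y).
  by do ?[apply: polyfun_add|apply: polyfun_mul|apply: polyfun_const].
apply/funext => x; apply/funext => y; apply: is_derive_unique.
have := is_derive_mult _ _ y _ _ (is_derive_pow _ n.+1 _ _ (dly x y)) (dqy x y) Rmult_comm.
set D := plus _ _; suff -> : D = l x y ^ n * (INR n.+1 * ly * q x y + l x y * qy x y) by [].
by rewrite /D /plus /mult /= -/(INR n.+1); ring.
Qed.

Lemma divisible_partial n a b f :
  divisible_by (a + b + n) f -> divisible_by n (partial_derive a b f).
Proof.
elim: a n => [|a IH] n.
  elim: b n => [|b IH] n; first by [].
  rewrite !add0n addSnnS => df.
  by apply: (divisible_Dy (f := partial_derive 0 b f)); apply: IH.
rewrite !addSn -addnS => df.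
by apply: (divisible_Dx (f := partial_derive a b f)); apply: IH.
Qed.

Lemma partial_vanish r a b q x y : polyfun q -> l x y = 0 -> (a + b <= r)%N ->
  partial_derive a b (fun x y => l x y ^ r.+1 * q x y) x y = 0.
Proof.
move=> pq l0 ab.
have [|u _ ->] := @divisible_partial (r - (a + b)).+1 a b (fun x y => l x y ^ r.+1 * q x y).
  by exists q; rewrite // addnS subnKC.
by rewrite l0 /= Rmult_0_l Rmult_0_l.
Qed.
End Vanishing.

Section Homogeneous.
Variable v : plane.

Definition homog d (P : {poly R}) (x y : R) : R :=
  pairing d P (fun a b => (x - v.1) ^ a * (y - v.2) ^ b).

Definition linform (a : plane) (x y : R) : R := a.1 * (x - v.1) + a.2 * (y - v.2).

Lemma polyfun_linform a : polyfun (linform a).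
Proof.
apply: polyfun_add; apply: polyfun_mul; try exact: polyfun_const;
  by apply: polyfun_add; constructor.
Qed.

Lemma is_derive_linform a x y :
  is_derive (fun z => linform a z y) x a.1 /\
  is_derive (fun z => linform a x z) y a.2.
Proof. by split; rewrite /linform; auto_derive => //; ring. Qed.

Lemma polyfun_pow f n : polyfun f -> polyfun (fun x y => f x y ^ n).
Proof.
move=> pf; elim: n => [|n IH]; first exact: polyfun_const.
exact: (polyfun_mul pf IH).
Qed.

Lemma polyfun_bigsum n (F : 'I_n -> R -> R -> R) :
  (forall j, polyfun (F j)) -> polyfun (fun x y => \sum_j F j x y)%R.
Proof.
elim: n F => [|n IH] F pF.
  rewrite (_ : (fun x y => _) = (fun _ _ => 0)); first exact: polyfun_const.
  by apply/funext => x; apply/funext => y; rewrite big_ord0.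
rewrite (_ : (fun x y => _) = (fun x y =>
  (\sum_(j < n) F (widen_ord (leqnSn n) j) x y)%R + F ord_max x y)).
  by apply: polyfun_add => //; apply: IH.
by apply/funext => x; apply/funext => y; rewrite big_ord_recr.
Qed.

Lemma polyfun_homog d P : polyfun (homog d P).
Proof.
apply: polyfun_bigsum => j; apply: (polyfun_mul (polyfun_const _)).
apply: polyfun_mul; apply: polyfun_pow; apply: polyfun_add;
  by [apply: polyfun_x|apply: polyfun_y|apply: polyfun_const].
Qed.

Lemma homogD d (P Q : {poly R}) x y : homog d (P + Q)%R x y = homog d P x y + homog d Q x y.
Proof. exact: pairingD. Qed.

Lemma homog_lform d (a : plane) (P : {poly R}) x y : (size P <= d.+1)%N ->
  homog d.+1 (lform a * P)%R x y = linform a x y * homog d P x y.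
Proof.
move=> sP; rewrite /homog pairing_lform // /pairing /linform.
rewrite Rmult_plus_distr_r -!RmultE -RplusE.
congr (_ + _); rewrite Rmult_assoc; congr (_ * _);
  rewrite RmultE mulr_sumr; apply: eq_bigr => j _; rewrite -!RmultE /=; ring.
Qed.

Lemma homog_lformX e k (a : plane) (Q : {poly R}) x y : (size Q <= k.+1)%N ->
  homog (e + k) (lform a ^+ e * Q)%R x y = linform a x y ^ e * homog k Q x y.
Proof.
move=> sQ; elim: e => [|e IH]; first by rewrite mul1r Rmult_1_l.
rewrite exprS -mulrA homog_lform; last by rewrite -addnS size_lformXM.
by rewrite IH -Rmult_assoc.
Qed.

Lemma homog_horner d (P : {poly R}) y : (size P <= d.+1)%N ->
  homog d P (v.1 + 1) (v.2 + y) = P.[y]%R.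
Proof.
move=> sP; rewrite (horner_coef_wide _ sP) /homog /pairing.
apply: eq_bigr => j _; congr (_ * _)%R.
rewrite (_ : v.1 + 1 - v.1 = 1); last ring.
rewrite (_ : v.2 + y - v.2 = y); last ring.
by rewrite pow1 Rmult_1_l RpowE.
Qed.

Lemma homog_scale d P u t :
  homog d P (v.1 + t * u.1) (v.2 + t * u.2) = homog d P (v.1 + u.1) (v.2 + u.2) * t ^ d.
Proof.
rewrite /homog /pairing [RHS]RmultE mulr_suml; apply: eq_bigr => j _.
rewrite -!RmultE.
rewrite (_ : v.1 + t * u.1 - v.1 = t * u.1); last ring.
rewrite (_ : v.2 + t * u.2 - v.2 = t * u.2); last ring.
rewrite (_ : v.1 + u.1 - v.1 = u.1); last ring.
rewrite (_ : v.2 + u.2 - v.2 = u.2); last ring.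
have -> : t ^ d = t ^ (d - j) * t ^ j.
  by rewrite -pow_add; congr (_ ^ _); have := ltn_ord j; lia.
rewrite !Rpow_mult_distr; ring.
Qed.

Lemma poly_nonroot (P : {poly R}) : P != 0%R -> exists y, (P.[y])%R <> 0.
Proof.
move=> P0; apply: contrapT => /forallNP nP.
have := @max_poly_roots _ P [seq (i%:R)%R | i <- iota 0 (size P)] P0.
rewrite size_map size_iota ltnn => h; suff : false by [].
apply: h; first by apply/allP => y _; apply/rootP; apply: contrapT; exact (nP y).
rewrite map_inj_uniq ?iota_uniq // => i j.
by rewrite -!INRE => /INR_eq.
Qed.

(** On the line through v with direction u, a homogeneous function of degree d is
    c t^d, whose d-th derivative is c d!.  If all derivatives of order d vanish
    at v, then c = 0 for every u = (1, y), and the values of P at all y are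
    zero. *)
Lemma homog_jet_neq0 d (P : {poly R}) : (size P <= d.+1)%N -> P != 0%R ->
  exists a b, (a + b)%N = d /\ jet (homog d P) v a b <> 0.
Proof.
move=> sP /poly_nonroot[y Py]; apply: contrapT => nj.
have {}nj a b : (a + b)%N = d -> jet (homog d P) v a b = 0.
  by move=> ab; apply: contrapT => j; apply: nj; exists a, b.
pose u : plane := (1, y); pose g := homog d P.
have sg : smooth_on setT g by apply/polyfun_smooth/polyfun_homog.
have oT : open (@setT plane) by move=> q _; apply: filter_true.
have dn n t : Derive_n (fun t => pairing 0 1 (jet g (along v u t))) n t =
    pairing n (lform u ^+ n)%R (jet g (along v u t)).
  elim: n t => [|n IH] t; first by [].
  rewrite /= (Derive_ext _ _ _ IH); apply: is_derive_unique.
  by rewrite exprS; apply: (is_derive_pairing oT sg) => //; apply: size_lformX.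
have := dn d 0.
rewrite {2}/pairing big1 => [|j _]; last first.
  rewrite /along !Rmult_0_l !Rplus_0_r -surjective_pairing nj ?mulr0 //.
  by rewrite subnK // -ltnS.
rewrite (Derive_n_ext _ (fun t => (P.[y])%R * t ^ d)) => [|t].
  rewrite Derive_n_scal_l Derive_n_pow_smalli // PeanoNat.Nat.sub_diag Rmult_1_r.
  rewrite Rdiv_1_r => /Rmult_integral[] //.
  exact/not_0_INR/Factorial.fact_neq_0.
rewrite -(homog_horner _ sP) /pairing big_ord1 coef1 mul1r.
exact: (homog_scale d P u t).
Qed.

End Homogeneous.

End PolynomialPieces.

(** * Triangles, edges and cones at a vertex *)

Definition cross (p q : plane) : R := p.1 * q.2 - p.2 * q.1.
Definition vadd (v p : plane) : plane := (v.1 + p.1, v.2 + p.2).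
Definition vscale (t : R) (p : plane) : plane := (t * p.1, t * p.2).

Lemma plane_eq (p : plane) x y : p = (x, y) -> p.1 = x /\ p.2 = y.
Proof. by move=> ->. Qed.

(** A triangle is given as a point set; its corners are recovered from it as its
    extreme points, defined by midpoints. *)
Definition extreme_point (T : set plane) (x : plane) : Prop :=
  T x /\ forall y z, T y -> T z ->
    x = ((y.1 + z.1) / 2, (y.2 + z.2) / 2) -> y = z.

Lemma hull3_swap a b c : hull3 a b c = hull3 b a c.
Proof.
apply/seteqP; split=> x [s [t [u [s0 t0 u0 stu ->]]]];
  by exists t, s, u; split=> //; [lra | congr (_, _); ring].
Qed.

Lemma hull3_rot a b c : hull3 a b c = hull3 b c a.
Proof.
apply/seteqP; split=> x.
  move=> [s [t [u [s0 t0 u0 stu ->]]]].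
  by exists t, u, s; split=> //; [lra | congr (_, _); ring].
move=> [s [t [u [s0 t0 u0 stu ->]]]].
by exists u, s, t; split=> //; [lra | congr (_, _); ring].
Qed.

Lemma noncollinear_rot a b c : noncollinear a b c -> noncollinear b c a.
Proof. by rewrite /noncollinear => n h; apply: n; rewrite -h; ring. Qed.

Lemma hull3_corner a b c : hull3 a b c a.
Proof.
exists 1, 0, 0; split; try lra.
by rewrite {1}[a]surjective_pairing; congr (_, _); ring.
Qed.

Lemma corner_extreme a b c : noncollinear a b c -> extreme_point (hull3 a b c) a.
Proof.
move=> nabc; split; first exact: hull3_corner.
move=> y z [s [t [u [s0 t0 u0 stu ->]]]] [s' [t' [u' [s'0 t'0 u'0 stu' ->]]]] /=.
move=> /plane_eq[e1 e2].
have [hs hs'] : s = 1 - t - u /\ s' = 1 - t' - u' by lra.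
subst s s'.
have E1 : (t + t') * (b.1 - a.1) + (u + u') * (c.1 - a.1) = 0 by lra.
have E2 : (t + t') * (b.2 - a.2) + (u + u') * (c.2 - a.2) = 0 by lra.
have tt' : t + t' = 0.
  apply: (Rmult_eq_reg_r ((b.1 - a.1) * (c.2 - a.2) - (b.2 - a.2) * (c.1 - a.1))) => //.
  transitivity (((t + t') * (b.1 - a.1) + (u + u') * (c.1 - a.1)) * (c.2 - a.2)
    - ((t + t') * (b.2 - a.2) + (u + u') * (c.2 - a.2)) * (c.1 - a.1)); first ring.
  by rewrite E1 E2; ring.
have uu' : u + u' = 0.
  apply: (Rmult_eq_reg_r ((b.1 - a.1) * (c.2 - a.2) - (b.2 - a.2) * (c.1 - a.1))) => //.
  transitivity (((t + t') * (b.2 - a.2) + (u + u') * (c.2 - a.2)) * (b.1 - a.1)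
    - ((t + t') * (b.1 - a.1) + (u + u') * (c.1 - a.1)) * (b.2 - a.2)); first ring.
  by rewrite E1 E2; ring.
have [-> ->] : t = 0 /\ t' = 0 by lra.
have [-> ->] : u = 0 /\ u' = 0 by lra.
by [].
Qed.

(** A point with two positive barycentric coordinates can be moved both ways
    along the corresponding side. *)
Lemma not_extreme a b c s t u : noncollinear a b c ->
  0 < s -> 0 < t -> 0 <= u -> s + t + u = 1 ->
  ~ extreme_point (hull3 a b c)
      (s * a.1 + t * b.1 + u * c.1, s * a.2 + t * b.2 + u * c.2).
Proof.
move=> nabc s0 t0 u0 stu [_ ext].
pose e := Rmin s t.
have e0 : 0 < e by apply: Rmin_glb_lt.
have es : e <= s by apply: Rmin_l.
have et : e <= t by apply: Rmin_r.
pose pt (k : R) : plane := ((s + k) * a.1 + (t - k) * b.1 + u * c.1,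
                (s + k) * a.2 + (t - k) * b.2 + u * c.2).
have hpt k : - e <= k <= e -> hull3 a b c (pt k).
  by move=> hk; exists (s + k), (t - k), u; split=> //; lra.
have /plane_eq[/= e1 e2] : pt e = pt (- e).
  by apply: ext; [apply: hpt; lra|apply: hpt; lra|rewrite /pt /=; congr (_, _); field].
have [h1 h2] : e * (b.1 - a.1) = 0 /\ e * (b.2 - a.2) = 0 by lra.
apply: nabc.
have -> : b.1 - a.1 = 0 by case/Rmult_integral: h1 => //; lra.
have -> : b.2 - a.2 = 0 by case/Rmult_integral: h2 => //; lra.
ring.
Qed.

Lemma extreme_corner a b c x : noncollinear a b c ->
  extreme_point (hull3 a b c) x -> [\/ x = a, x = b | x = c].
Proof.
move=> nabc ex; have [[s [t [u [s0 t0 u0 stu xE]]]] _] := ex.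
have st : s = 0 \/ t = 0.
  case: (Req_dec s 0) => [|sn]; first by left.
  case: (Req_dec t 0) => [|tn]; first by right.
  have [] := @not_extreme a b c s t u nabc; try lra.
  by rewrite -xE.
have tu : t = 0 \/ u = 0.
  case: (Req_dec t 0) => [|tn]; first by left.
  case: (Req_dec u 0) => [|un]; first by right.
  have [] := @not_extreme b c a t u s (noncollinear_rot nabc); try lra.
  rewrite -hull3_rot (_ : (_, _) = x) // xE; congr (_, _); ring.
have su : s = 0 \/ u = 0.
  case: (Req_dec s 0) => [|sn]; first by left.
  case: (Req_dec u 0) => [|un]; first by right.
  have [] := @not_extreme c a b u s t (noncollinear_rot (noncollinear_rot nabc)); try lra.
  rewrite -hull3_rot -hull3_rot (_ : (_, _) = x) // xE; congr (_, _); ring.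
have xs r : r = (r.1, r.2) :> plane by case: r.
have [[s1 [t1 u1]]|[[s1 [t1 u1]]|[s1 [t1 u1]]]] :
  (s = 1 /\ t = 0 /\ u = 0) \/ (s = 0 /\ t = 1 /\ u = 0) \/ (s = 0 /\ t = 0 /\ u = 1) by lra.
- by apply: Or31; rewrite xE s1 t1 u1 [RHS]xs; congr (_, _); ring.
- by apply: Or32; rewrite xE s1 t1 u1 [RHS]xs; congr (_, _); ring.
- by apply: Or33; rewrite xE s1 t1 u1 [RHS]xs; congr (_, _); ring.
Qed.

Lemma segment_sym a b : segment a b = segment b a.
Proof.
apply/seteqP; split=> x [t t01 ->]; exists (1 - t); try lra;
  by rewrite /affine2; congr (_, _); ring.
Qed.

Section Cone.
Variables (v p q : plane).
Hypothesis pq : 0 < cross p q.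

Definition tri : set plane := hull3 v (vadd v p) (vadd v q).
Definition cone (w : plane) : Prop := 0 <= cross p w /\ 0 <= cross w q.

Lemma tri_noncollinear : noncollinear v (vadd v p) (vadd v q).
Proof.
rewrite /noncollinear /vadd /=; move: pq; rewrite /cross => h.
by apply: Rgt_not_eq; ring_simplify; lra.
Qed.

Lemma triE w : tri (vadd v w) <-> cone w /\ cross w q + cross p w <= cross p q.
Proof.
split.
  move=> [s [t [u [s0 t0 u0 stu /= [e1 e2]]]]].
  have hs : s = 1 - t - u by lra.
  subst s.
  have w1 : w.1 = t * p.1 + u * q.1 by lra.
  have w2 : w.2 = t * p.2 + u * q.2 by lra.
  have c1 : cross p w = u * cross p q by rewrite /cross w1 w2; ring.
  have c2 : cross w q = t * cross p q by rewrite /cross w1 w2; ring.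
  rewrite /cone c1 c2; split; [split|]; nra.
move=> [[c1 c2] c3].
exists (1 - cross w q / cross p q - cross p w / cross p q),
  (cross w q / cross p q), (cross p w / cross p q).
have D0 : cross p q <> 0 by lra.
have h1 : 0 <= cross w q / cross p q by apply: Rdiv_le_0_compat.
have h2 : 0 <= cross p w / cross p q by apply: Rdiv_le_0_compat.
have h3 : cross w q / cross p q + cross p w / cross p q <= 1.
  by rewrite -Rdiv_plus_distr; apply/Rle_div_l; lra.
split=> //; try lra.
by rewrite /vadd /=; congr (_, _); move: D0; rewrite /cross => D0; field.
Qed.

Lemma tri_v : tri v.
Proof. exact: hull3_corner. Qed.

(** Near the vertex a triangle coincides with its cone. *)
Lemma cone_tri w : cone w ->
  exists2 d, 0 < d & forall t, 0 <= t <= d -> tri (vadd v (vscale t w)).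
Proof.
move=> [c1 c2]; pose D := cross p q + cross w q + cross p w.
have D0 : 0 < D by rewrite /D; lra.
have d0 : 0 < cross p q / D by apply: Rdiv_lt_0_compat.
exists (cross p q / D) => // t [t0 td]; apply/triE.
have -> : cross (vscale t w) q = t * cross w q by rewrite /cross /=; ring.
have e : cross p (vscale t w) = t * cross p w by rewrite /cross /=; ring.
rewrite /cone e.
have -> : cross (vscale t w) q = t * cross w q by rewrite /cross /=; ring.
split; first by split; nra.
have : t * D <= cross p q by apply/Rle_div_r.
rewrite /D; nra.
Qed.

(** The ends of an edge are extreme points, hence corners; the side opposite to v
    does not contain v. *)
Lemma tri_edge e : is_edge tri e -> e v ->
  e = segment v (vadd v p) \/ e = segment v (vadd v q).
Proof.
move=> [a [b [c [nabc Tabc ->]]]] ev.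
have nT := tri_noncollinear.
have ea : extreme_point tri a by rewrite Tabc; apply: corner_extreme.
have eb : extreme_point tri b.
  by rewrite Tabc hull3_rot; apply/corner_extreme/noncollinear_rot.
have ab : a <> b.
  by move=> ab; apply: nabc; rewrite ab; ring.
have nv : ~ segment (vadd v p) (vadd v q) v.
  move=> [t t01]; rewrite /affine2 /= [v]surjective_pairing => -[/= e1 e2].
  have w1 : (1 - t) * p.1 + t * q.1 = 0 by lra.
  have w2 : (1 - t) * p.2 + t * q.2 = 0 by lra.
  have h1 : t * cross p q = 0.
    transitivity (p.1 * ((1 - t) * p.2 + t * q.2) - p.2 * ((1 - t) * p.1 + t * q.1)).
      by rewrite /cross; ring.
    by rewrite w1 w2; ring.
  have h2 : (1 - t) * cross p q = 0.
    transitivity (((1 - t) * p.1 + t * q.1) * q.2 - ((1 - t) * p.2 + t * q.2) * q.1).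
      by rewrite /cross; ring.
    by rewrite w1 w2; ring.
  lra.
case: (extreme_corner nT ea) ev ab => ->; case: (extreme_corner nT eb) => -> ev ab //;
  try (by left); try (by right).
- by left; rewrite segment_sym.
- by right; rewrite segment_sym.
- by case: nv; rewrite segment_sym.
Qed.

Lemma tri_edge_p : is_edge tri (segment v (vadd v p)).
Proof. by exists v, (vadd v p), (vadd v q); split=> //; apply: tri_noncollinear. Qed.

End Cone.

Lemma segment_cross v p w t : t <> 0 ->
  segment v (vadd v p) (vadd v (vscale t w)) -> cross p w = 0.
Proof.
move=> t0 [s _ []] /= e1 e2.
have w1 : t * w.1 = s * p.1 by lra.
have w2 : t * w.2 = s * p.2 by lra.
apply: (Rmult_eq_reg_l t) => //.
transitivity (p.1 * (t * w.2) - p.2 * (t * w.1)); first by rewrite /cross; ring.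
by rewrite w1 w2; ring.
Qed.

Lemma segment_inj v p q : p <> (0, 0) ->
  segment v (vadd v p) = segment v (vadd v q) -> p = q.
Proof.
move=> p0 E.
have end_mem x : segment v (vadd v x) (vadd v x).
  by exists 1; [lra|rewrite /affine2 /vadd /=; congr (_, _); ring].
have [t t01 [/= e1 e2]] : segment v (vadd v q) (vadd v p) by rewrite -E.
have [s s01 [/= f1 f2]] : segment v (vadd v p) (vadd v q) by rewrite E.
have p1 : p.1 = t * q.1 by lra.
have p2 : p.2 = t * q.2 by lra.
have q1 : q.1 = s * p.1 by lra.
have q2 : q.2 = s * p.2 by lra.
have ts : t * s = 1.
  have h1 : (t * s - 1) * p.1 = 0 by move: p1; rewrite q1; lra.
  have h2 : (t * s - 1) * p.2 = 0 by move: p2; rewrite q2; lra.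
  case/Rmult_integral: h1 => [|h1]; first by lra.
  case/Rmult_integral: h2 => [|h2]; first by lra.
  by case: p0; rewrite [p]surjective_pairing h1 h2.
have t1 : t = 1 by nra.
by rewrite [p]surjective_pairing [q]surjective_pairing p1 p2 t1; congr (_, _); ring.
Qed.

(** * The cyclic order of the triangles of a cell *)

Lemma finite_pos_min (I : finType) (e : I -> R) : (forall i, 0 < e i) ->
  exists2 d, 0 < d & forall i, d <= e i.
Proof.
move=> e0; suff [d d0 de] : exists2 d, 0 < d & forall i, i \in enum I -> d <= e i.
  by exists d => // i; apply: de; rewrite mem_enum.
elim: (enum I) => [|i s [d d0 IH]]; first by exists 1; first lra.
exists (Rmin (e i) d); first exact: Rmin_glb_lt.
move=> j; rewrite inE => /orP[/eqP->|/IH]; first exact: Rmin_l.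
by move=> ?; apply: Rle_trans (Rmin_r _ _) _.
Qed.

Lemma continuity_Rmax f g : continuity f -> continuity g ->
  continuity (fun t => Rmax (f t) (g t)).
Proof.
move=> cf cg t.
have -> : (fun t => Rmax (f t) (g t)) =
    (fun t => (f t + g t + Rabs (f t - g t)) * / 2).
  apply/funext => x; rewrite /Rmax /Rabs.
  by case: Rle_dec; case: Rcase_abs; lra.
apply: continuity_pt_mult; last exact: continuity_pt_const.
apply: continuity_pt_plus; first exact: continuity_pt_plus.
apply: (continuity_pt_comp (fun t => f t - g t) Rabs).
  exact: continuity_pt_minus.
exact: Rcontinuity_abs.
Qed.

Lemma finite_max_continuous (I : eqType) (phi : I -> R -> R) (i0 : I) (s : seq I) :
  (forall i, continuity (phi i)) ->
  exists M : R -> R, [/\ continuity M,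
    forall t, exists2 i, i \in i0 :: s & M t = phi i t &
    forall t i, i \in i0 :: s -> phi i t <= M t].
Proof.
move=> cphi; elim: s i0 => [|j s IH] i0.
  exists (phi i0); split=> // t; first by exists i0; rewrite ?mem_head.
  by move=> i; rewrite inE => /eqP ->; lra.
have [M [cM attM maxM]] := IH j.
exists (fun t => Rmax (phi i0 t) (M t)); split=> [|t|t i].
- exact: continuity_Rmax.
- have [i iin Mi] := attM t.
  rewrite /Rmax; case: Rle_dec => _; last by exists i0; rewrite ?mem_head.
  by exists i; rewrite // inE iin orbT.
- rewrite inE => /orP[/eqP ->|iin]; first exact: Rmax_l.
  by apply: Rle_trans (maxM _ _ iin) (Rmax_r _ _).
Qed.

(** The triangles around v in counterclockwise order: [p i] is the first side of
    triangle [T i], and [s i] is the next triangle, whose first side is the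
    second side of [T i]. *)
Record fan (v : plane) (I : finType) (T : I -> set plane) (p : I -> plane)
    (s : I -> I) : Prop := Fan {
  fan_pos : forall i, 0 < cross (p i) (p (s i));
  fan_tri : forall i, T i = tri v (p i) (p (s i));
  fan_inj : injective s;
  fan_conn : forall i j, fconnect s i j;
  fan_edge : forall i, common_edge (T i) (T (s i)) (T i `&` T (s i)) /\
     T i `&` T (s i) = segment v (vadd v (p (s i)));
  fan_adj : forall i j, i != j -> common_edge (T i) (T j) (T i `&` T j) ->
     j = s i \/ i = s j }.

Lemma fan_neq0 v (I : finType) (T : I -> set plane) p s :
  fan v T p s -> forall i, p i <> (0, 0).
Proof. by move=> fT i pi; have := fan_pos fT i; rewrite pi /cross /=; lra. Qed.

Arguments fan_neq0 {v I T p s} _ i _.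

Section Fan.
Variables (v : plane) (I : finType) (T : I -> set plane) (p q : I -> plane).
Hypotheses (pq : forall i, 0 < cross (p i) (q i))
  (TE : forall i, T i = tri v (p i) (q i))
  (T_inj : injective T)
  (T_meet : forall i j, i != j ->
     (exists x, T i `&` T j = [set x]) \/ common_edge (T i) (T j) (T i `&` T j))
  (T_cover : forall w, exists i, cone (p i) (q i) w).

Let p0 i : p i <> (0, 0).
Proof. by move=> pi; have := pq i; rewrite pi /cross /=; lra. Qed.

Let q0 i : q i <> (0, 0).
Proof. by move=> qi; have := pq i; rewrite qi /cross /=; lra. Qed.

Let cone_p i : cone (p i) (q i) (p i).
Proof. by split; [rewrite /cross; lra|have := pq i; lra]. Qed.

Let cone_q i : cone (p i) (q i) (q i).
Proof. by split; [have := pq i; lra|rewrite /cross; lra]. Qed.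

Let cone_meet i j w : cone (p i) (q i) w -> cone (p j) (q j) w ->
  exists2 d, d <> 0 & (T i `&` T j) (vadd v (vscale d w)).
Proof.
move=> /(cone_tri v (pq i))[d d0 di] /(cone_tri v (pq j))[e e0 ej].
have m0 : 0 < Rmin d e by apply: Rmin_glb_lt.
exists (Rmin d e); first lra.
split; rewrite TE; [apply: di|apply: ej]; split; try lra;
  [exact: Rmin_l | exact: Rmin_r].
Qed.

Let cone_common i j w : i != j -> w <> (0, 0) ->
  cone (p i) (q i) w -> cone (p j) (q j) w -> common_edge (T i) (T j) (T i `&` T j).
Proof.
move=> ij w0 ci cj; case: (T_meet ij) => // -[x E].
have [d d0] := cone_meet ci cj; rewrite E /= => xd.
have : (T i `&` T j) v by rewrite !TE; split; apply: tri_v.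
rewrite E /= => vx; case: w0.
move: xd; rewrite -vx [w]surjective_pairing [v]surjective_pairing => -[/= h1 h2].
have e1 : d * w.1 = 0 by lra.
have e2 : d * w.2 = 0 by lra.
by case/Rmult_integral: e1 => // ->; case/Rmult_integral: e2 => // ->.
Qed.

Let edge_cases i j : common_edge (T i) (T j) (T i `&` T j) ->
  (T i `&` T j = segment v (vadd v (p i)) \/ T i `&` T j = segment v (vadd v (q i))) /\
  (T i `&` T j = segment v (vadd v (p j)) \/ T i `&` T j = segment v (vadd v (q j))).
Proof.
have vij : (T i `&` T j) v by rewrite !TE; split; apply: tri_v.
move=> [ei ej]; split.
  by apply: (tri_edge (pq i)) vij; rewrite -TE.
by apply: (tri_edge (pq j)) vij; rewrite -TE.
Qed.

Let crossC (x y : plane) : cross y x = - cross x y.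
Proof. by rewrite /cross; ring. Qed.

Let crossDl (x y z : plane) : cross (vadd x y) z = cross x z + cross y z.
Proof. by rewrite /cross /=; ring. Qed.

Let crossDr (x y z : plane) : cross z (vadd x y) = cross z x + cross z y.
Proof. by rewrite /cross /=; ring. Qed.

Let crossxx (x : plane) : cross x x = 0.
Proof. by rewrite /cross; ring. Qed.

Let cross_neq0 (x w : plane) : cross x w <> 0 -> w <> (0, 0).
Proof. by move=> h w0; apply: h; rewrite w0 /cross /=; ring. Qed.

(** Two cones with the same first ray p and second rays q and q' both contain
    p + q or p + q', which is off the common ray: the triangles then share more
    than an edge. *)
Let start_inj i j : p i = p j -> i = j.
Proof.
move=> pij; apply: contrapT => /eqP ij.
have [Di Dj] := (pq i, pq j).
have [w [ci cj pw]] : exists w, [/\ cone (p i) (q i) w,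
    cone (p j) (q j) w & cross (p i) w <> 0].
  have [h|h] := Rle_lt_dec 0 (cross (q i) (q j)).
    exists (vadd (p i) (q i)).
    by rewrite /cone !crossDl !crossDr -!pij !crossxx; rewrite -pij in Dj; split; lra.
  exists (vadd (p i) (q j)).
  rewrite /cone !crossDl !crossDr -!pij !crossxx (crossC (q i) (q j)).
  by rewrite -pij in Dj; split; lra.
have [d d0 wd] := cone_meet ci cj.
have [+ +] := edge_cases (cone_common ij (cross_neq0 pw) ci cj).
have np : T i `&` T j <> segment v (vadd v (p i)).
  by move=> E; rewrite E in wd; apply: pw; apply: segment_cross d0 wd.
case=> [//|Eq] []; first by rewrite -pij.
rewrite Eq => /(segment_inj (@q0 i)) qij.
by case/eqP: ij; apply: T_inj; rewrite !TE pij qij.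
Qed.

Let end_inj i j : q i = q j -> i = j.
Proof.
move=> qij; apply: contrapT => /eqP ij.
have [Di Dj] := (pq i, pq j).
have [w [ci cj wq]] : exists w, [/\ cone (p i) (q i) w,
    cone (p j) (q j) w & cross (q i) w <> 0].
  have [h|h] := Rle_lt_dec 0 (cross (p j) (p i)).
    exists (vadd (p i) (q i)).
    rewrite /cone !crossDl !crossDr -!qij !crossxx (crossC (p i) (q i)).
    by rewrite -qij in Dj; split; lra.
  exists (vadd (p j) (q i)).
  rewrite /cone !crossDl !crossDr -!qij !crossxx (crossC (p j) (q i)) (crossC (p j) (p i)).
  by rewrite -qij in Dj; split; lra.
have [d d0 wd] := cone_meet ci cj.
have [+ +] := edge_cases (cone_common ij (cross_neq0 wq) ci cj).
have nq : T i `&` T j <> segment v (vadd v (q i)).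
  by move=> E; rewrite E in wd; apply: wq; apply: segment_cross d0 wd.
case=> [Ep|//] []; last by rewrite -qij.
rewrite Ep => /(segment_inj (@p0 i)) pij.
by case/eqP: ij; apply: T_inj; rewrite !TE pij qij.
Qed.

Let edge_succ i j : i != j -> common_edge (T i) (T j) (T i `&` T j) ->
  (q i = p j /\ T i `&` T j = segment v (vadd v (p j))) \/
  (q j = p i /\ T i `&` T j = segment v (vadd v (p i))).
Proof.
move=> ij /edge_cases[[Ei|Ei] [Ej|Ej]].
- by move: ij; rewrite (@start_inj i j) ?eqxx //; apply: (@segment_inj v); rewrite -?Ei.
- by right; split=> //; apply/esym/(@segment_inj v); rewrite -?Ei.
- by left; split=> //; apply: (@segment_inj v); rewrite -?Ei.
- by move: ij; rewrite (@end_inj i j) ?eqxx //; apply: (@segment_inj v); rewrite -?Ei.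
Qed.

(** The directions just beyond the last ray of a cone are covered by the other
    cones.  These are closed and finite in number, so one of them contains that
    ray, and the corresponding triangle shares the edge on it. *)
Let succ_exists i : exists j, q i = p j.
Proof.
have [j [ij cj]] : exists j, i != j /\ cone (p j) (q j) (q i).
  apply: contrapT => nj.
  pose w (t : R) : plane := vadd (q i) (vscale (- t) (p i)).
  have wE x t : cross x (w t) = cross x (q i) - t * cross x (p i).
    by rewrite /w /cross /=; ring.
  have we x t : cross (w t) x = cross (q i) x - t * cross (p i) x.
    by rewrite /w /cross /=; ring.
  have small c k : c < 0 -> exists2 e, 0 < e & forall t, 0 < t <= e -> c - t * k < 0.
    move=> c0; have k0 := Rabs_pos k; exists (- c / (2 * (1 + Rabs k))).
      by apply: Rdiv_lt_0_compat; lra.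
    move=> t [t0 /Rle_div_r te].
    have {}te : t * (2 * (1 + Rabs k)) <= - c by apply: te; lra.
    have := Rabs_maj2 k; nra.
  have /choice[e eP] j : exists e, 0 < e /\
      (i != j -> forall t, 0 < t <= e -> ~ cone (p j) (q j) (w t)).
    have [_|ij] := eqVneq i j; first by exists 1; split=> //; lra.
    have [h|h] : cross (p j) (q i) < 0 \/ cross (q i) (q j) < 0.
      apply: contrapT => h; apply: nj; exists j; split=> //.
      by rewrite /cone; split; apply: Rnot_lt_le => ?; apply: h; [left|right].
    - have [e e0 eh] := small _ (cross (p j) (p i)) h.
      by exists e; split=> // _ t te [+ _]; rewrite wE; have := eh t te; lra.
    - have [e e0 eh] := small _ (cross (p i) (q j)) h.
      by exists e; split=> // _ t te [_ +]; rewrite we; have := eh t te; lra.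
  have [d d0 de] := finite_pos_min (fun j => proj1 (eP j)).
  have [j cj] := T_cover (w d).
  have ij : i != j.
    apply/eqP => ij; move: cj; rewrite -ij => -[_].
    by rewrite we crossxx; have := pq i; nra.
  by have [_ /(_ ij d (conj d0 (de j)))] := eP j.
have [[? _]|[qj E]] := edge_succ ij (cone_common ij (@q0 i) (cone_q i) cj); first by exists j.
have [d d0] := cone_meet (cone_q i) cj.
rewrite E => /(segment_cross d0); have := pq i; lra.
Qed.

(** The cones of an orbit of the successor map and those of its complement are
    two closed families that cover the plane.  On a segment from one family to
    the other that avoids the origin they meet, so that triangles of different
    orbits are adjacent, which is absurd. *)
Let orbit_full (s : I -> I) : (forall i, q i = p (s i)) -> injective s ->
  forall i j, fconnect s i j.
Proof.
move=> qs s_inj i0 j0; apply: contrapT => /negP nij.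
have apart i j w : fconnect s i0 i -> ~~ fconnect s i0 j -> w <> (0, 0) ->
    cone (p i) (q i) w -> ~ cone (p j) (q j) w.
  move=> ci nj w0 wi wj.
  have ij : i != j by apply: contraNneq nj => <-.
  have [[e _]|[e _]] := edge_succ ij (cone_common ij w0 wi wj).
    move: e; rewrite qs => /start_inj e; case/negP: nj.
    by rewrite -e (connect_trans ci) // fconnect1.
  move: e; rewrite qs => /start_inj e; case/negP: nj.
  by rewrite (same_fconnect1_r s_inj) e.
have Dj := pq j0; have Di := pq i0.
pose b := vadd (p j0) (q j0).
have cb : cone (p j0) (q j0) b by rewrite /cone crossDl crossDr !crossxx; split; lra.
have b0 : b <> (0, 0) by apply: (@cross_neq0 (p j0)); rewrite crossDr crossxx; lra.
(* If a and b were parallel, the segment could run through the origin. *)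
have [a [ca a0 ab]] : exists a, [/\ cone (p i0) (q i0) a, a <> (0, 0) & cross a b <> 0].
  have [h|h] := Req_dec (cross (p i0) b) 0.
    have [h'|h'] := Req_dec (cross (q i0) b) 0; last by exists (q i0).
    case: b0; have e1 : cross (p i0) (q i0) * b.1 = 0.
      transitivity ((q i0).1 * cross (p i0) b - (p i0).1 * cross (q i0) b).
        by rewrite /cross; ring.
      by rewrite h h'; ring.
    have e2 : cross (p i0) (q i0) * b.2 = 0.
      transitivity ((q i0).2 * cross (p i0) b - (p i0).2 * cross (q i0) b).
        by rewrite /cross; ring.
      by rewrite h h'; ring.
    rewrite [b]surjective_pairing.
    by congr (_, _); [case/Rmult_integral: e1|case/Rmult_integral: e2] => //; lra.
  by exists (p i0).
pose w (t : R) : plane := vadd (vscale (1 - t) a) (vscale t b).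
have crossw x t : cross x (w t) = (1 - t) * cross x a + t * cross x b.
  by rewrite /w /cross /=; ring.
have wcross x t : cross (w t) x = (1 - t) * cross a x + t * cross b x.
  by rewrite /w /cross /=; ring.
have w0 t : w t <> (0, 0).
  move=> wt; have := crossw a t; have := wcross b t.
  rewrite wt !crossxx /cross /= -/(cross a b) => h1 h2.
  have {}h1 : (1 - t) * cross a b = 0 by rewrite /cross; lra.
  have {}h2 : t * cross a b = 0 by rewrite /cross; lra.
  by apply: ab; lra.
have wa : w 0 = a by rewrite [a]surjective_pairing /w /vadd /=; congr (_, _); ring.
have wb : w 1 = b by rewrite [b]surjective_pairing /w /vadd /=; congr (_, _); ring.
(* phi i t is nonnegative exactly when w t lies in the cone i; the maxima of
   phi over the two families are equal at some point, by the intermediate value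
   theorem, and nonnegative there since the cones cover. *)
pose phi i t := - Rmax (- cross (p i) (w t)) (- cross (w t) (q i)).
have cphi i : continuity (phi i).
  have caff c d : continuity (fun t => - ((1 - t) * c + t * d)).
    by apply/derivable_continuous => t; apply/ex_derive_Reals_0; auto_derive.
  apply: continuity_opp; apply: continuity_Rmax.
    rewrite (_ : (fun t => _) = fun t => - ((1 - t) * cross (p i) a + t * cross (p i) b)) //.
    by apply/funext => t; rewrite crossw.
  rewrite (_ : (fun t => _) = fun t => - ((1 - t) * cross a (q i) + t * cross b (q i))) //.
  by apply/funext => t; rewrite wcross.
have phi_cone i t : 0 <= phi i t <-> cone (p i) (q i) (w t).
  rewrite /phi /cone; have := Rmax_l (- cross (p i) (w t)) (- cross (w t) (q i)).
  have := Rmax_r (- cross (p i) (w t)) (- cross (w t) (q i)).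
  split; first lra; move=> [c1 c2].
  have : Rmax (- cross (p i) (w t)) (- cross (w t) (q i)) <= 0 by apply: Rmax_lub; lra.
  lra.
pose A := [seq i <- enum I | fconnect s i0 i].
pose B := [seq i <- enum I | ~~ fconnect s i0 i].
have inA i : i \in i0 :: A = fconnect s i0 i.
  by rewrite inE mem_filter mem_enum andbT orb_idl // => /eqP ->; apply: connect0.
have inB i : i \in j0 :: B = ~~ fconnect s i0 i.
  by rewrite inE mem_filter mem_enum andbT orb_idl // => /eqP ->.
have [MA [cA attA maxA]] := finite_max_continuous i0 A cphi.
have [MB [cB attB maxB]] := finite_max_continuous j0 B cphi.
have hA : MB 0 < 0 <= MA 0.
  split; last first.
    apply: Rle_trans (maxA 0 i0 _); last by rewrite inA connect0.
    by apply/phi_cone; rewrite wa.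
  have [j + ->] := attB 0; rewrite inB => jB.
  apply: Rnot_le_lt => /phi_cone; rewrite wa.
  exact: apart (connect0 _ _) jB a0 ca.
have hB : MA 1 < 0 <= MB 1.
  split; last first.
    apply: Rle_trans (maxB 1 j0 _); last by rewrite inB.
    by apply/phi_cone; rewrite wb.
  have [i + ->] := attA 1; rewrite inA => iA.
  apply: Rnot_le_lt => /phi_cone; rewrite wb => ci.
  exact: (apart _ _ _ iA nij b0 ci).
have [|||z [_ hz]] := IVT_cor (fun t => MA t - MB t) 0 1.
- exact: continuity_minus.
- lra.
- have : (MA 0 - MB 0) * - (MA 1 - MB 1) >= 0.
    by apply: Rle_ge; apply: Rmult_le_pos; lra.
  lra.
have [i + Ei] := attA z; have [j + Ej] := attB z; rewrite inA inB => jB iA.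
have [k /phi_cone kz] := T_cover (w z).
have MA0 : 0 <= MA z.
  case: (boolP (fconnect s i0 k)) => [kA|kB].
    by apply: Rle_trans kz (maxA z k _); rewrite inA.
  by have := maxB z k; rewrite inB => /(_ kB); lra.
have ci : cone (p i) (q i) (w z) by apply/phi_cone; lra.
apply: (apart i j (w z)) => //; apply/phi_cone; lra.
Qed.

Lemma fan_of_cones : exists s, fan v T p s.
Proof.
have [s qs] := choice succ_exists.
have s_inj : injective s by move=> i j sij; apply: end_inj; rewrite !qs sij.
have si i : i != s i.
  apply/eqP => e; have := pq i; rewrite qs -e crossxx; lra.
exists s; split=> //.
- by move=> i; rewrite -qs.
- by move=> i; rewrite -qs.
- exact: orbit_full.
- move=> i; have ce : common_edge (T i) (T (s i)) (T i `&` T (s i)).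
    apply: (cone_common (si i) (@q0 i) (cone_q i)); by rewrite (qs i); apply: cone_p.
  split=> //; case: (edge_succ (si i) ce) => -[e E] //.
  have := pq (s i); rewrite e => h; exfalso.
  have := pq i; rewrite qs crossC; lra.
- move=> i j ij /(edge_succ ij)[[e _]|[e _]]; [left|right]; apply: start_inj;
    by rewrite -qs.
Qed.
End Fan.

(** * Cells and their slopes *)

Lemma vertex_tri T v : is_vertex T v ->
  exists pq : plane * plane, 0 < cross pq.1 pq.2 /\ T = tri v pq.1 pq.2.
Proof.
move=> [b [c [nvbc ->]]].
have bE x : x = vadd v (x.1 - v.1, x.2 - v.2).
  by rewrite {1}[x]surjective_pairing /vadd /=; congr (_, _); ring.
pose p : plane := (b.1 - v.1, b.2 - v.2); pose q : plane := (c.1 - v.1, c.2 - v.2).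
have [h|h] := Rlt_le_dec 0 (cross p q).
  by exists (p, q); split=> //=; rewrite /tri -!bE.
exists (q, p); split=> /=.
  move: nvbc h; rewrite /noncollinear /cross /= => n h.
  have [] := Rdichotomy _ _ n; lra.
by rewrite /tri -!bE hull3_rot hull3_swap -hull3_rot.
Qed.

(** Once each triangle is oriented, what remains is that the cones cover the
    plane: small multiples of any vector, added to v, stay in the neighbourhood
    of v that the triangles cover. *)
Lemma cell_fan v m Delta : interior_cell v m Delta ->
  exists (T : 'I_m -> set plane) p s,
    [/\ fan v T p s, injective T & forall A, Delta A <-> exists i, A = T i].
Proof.
move=> [card_m vert meet vin].
have /card_set_bijP[f [fD f_inj fS]] := card_esym card_m.
pose T (i : 'I_m) := f i.
have DT i : Delta (T i) by apply: fD; exact: ltn_ord.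
have DE A : Delta A <-> exists i, A = T i.
  split=> [/fS[n /= nm <-]|[i ->]] //.
  by exists (Ordinal nm).
have T_inj : injective T.
  by move=> i j /f_inj ij; apply/val_inj/ij; apply/mem_set; exact: ltn_ord.
have /choice[pq pqT] i := vertex_tri (proj2 (vert _ (DT i))).
exists T; have [||s sfan] := @fan_of_cones v _ T (fun i => (pq i).1) (fun i => (pq i).2)
    (fun i => proj1 (pqT i)) (fun i => proj2 (pqT i)) T_inj; last first.
- by exists (fun i => (pq i).1), s.
- move=> w.
  have [e he] := vin; have e0 := cond_pos e.
  pose N := 1 + Rabs w.1 + Rabs w.2.
  have N0 : 0 < N by rewrite /N; have := Rabs_pos w.1; have := Rabs_pos w.2; lra.
  pose d := e / (2 * N).
  have d0 : 0 < d by apply: Rdiv_lt_0_compat; lra.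
  have dN : d * N = e / 2 by rewrite /d; field; lra.
  have small x : Rabs x <= N -> Rabs (d * x) < e.
    by move=> xN; rewrite Rabs_mult (Rabs_pos_eq d); nra.
  have [|A /DE[i ->]] := he (vadd v (vscale d w)).
    have bx (x y : R) : Rabs y < e -> ball x e (x + y).
      rewrite /ball /= /AbsRing_ball /abs /minus /plus /Hierarchy.opp /=.
      by rewrite (_ : x + y + - x = y) //; ring.
    have := Rabs_pos w.1; have := Rabs_pos w.2 => *.
    by split; apply: bx; apply: small; rewrite /N /=; lra.
  rewrite (proj2 (pqT i)) => /(triE _ (proj1 (pqT i)))[[c1 c2] _].
  exists i; split.
    have e1 : cross (pq i).1 (vscale d w) = d * cross (pq i).1 w by rewrite /cross /=; ring.
    by rewrite e1 in c1; nra.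
  have e1 : cross (vscale d w) (pq i).2 = d * cross w (pq i).2 by rewrite /cross /=; ring.
  by rewrite e1 in c2; nra.
- move=> i j ij.
  case: (meet _ _ (DT i) (DT j)) => [/T_inj/eqP|[x [_ E]]|];
    [|by left; exists x|by right].
  by rewrite (negbTE ij).
Qed.

Lemma line_ends a b : line_through a b a /\ line_through a b b.
Proof.
split; [exists 0|exists 1]; rewrite /affine2;
  [rewrite {1}[a]surjective_pairing|rewrite {1}[b]surjective_pairing];
  congr (_, _); ring.
Qed.

Lemma line_unique a b v p : p <> (0, 0) -> line_through a b v ->
  line_through a b (vadd v p) -> line_through a b = line_through v (vadd v p).
Proof.
move=> p0 [t0 /plane_eq[a1 a2]] [t1 [/= b1 b2]].
have p1E : p.1 = (t1 - t0) * (b.1 - a.1) by lra.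
have p2E : p.2 = (t1 - t0) * (b.2 - a.2) by lra.
have t10 : t1 - t0 <> 0.
  by move=> t10; apply: p0; rewrite [p]surjective_pairing p1E p2E t10; congr (_, _); ring.
apply/seteqP; split=> x [t ->].
  exists ((t - t0) / (t1 - t0)); rewrite /affine2 /vadd /= p1E p2E a1 a2.
  by congr (_, _); field.
exists (t0 + t * (t1 - t0)); rewrite /affine2 /vadd /= p1E p2E a1 a2.
by congr (_, _); ring.
Qed.

Lemma cross_eq0_scale p q : p <> (0, 0) -> cross p q = 0 -> exists t, q = vscale t p.
Proof.
move=> p0; rewrite /cross => pq.
have [p1|p1] := Req_dec p.1 0; last first.
  exists (q.1 / p.1); rewrite [LHS]surjective_pairing /vscale; congr (_, _); first by field.
  apply: (Rmult_eq_reg_l p.1) => //.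
  transitivity (p.2 * q.1); first lra.
  by field.
have p2 : p.2 <> 0 by move=> p2; apply: p0; rewrite [p]surjective_pairing p1 p2.
exists (q.2 / p.2); rewrite [LHS]surjective_pairing /vscale; congr (_, _); last by field.
apply: (Rmult_eq_reg_l p.2) => //.
transitivity (p.1 * q.2); first lra.
by rewrite p1; field.
Qed.

Lemma line_cross v p q : p <> (0, 0) -> q <> (0, 0) ->
  line_through v (vadd v p) = line_through v (vadd v q) <-> cross p q = 0.
Proof.
move=> p0 q0; split=> [E|/(cross_eq0_scale p0)[t qE]].
  have [_] := line_ends v (vadd v q); rewrite -E => -[t [/= e1 e2]].
  have q1 : q.1 = t * p.1 by lra.
  have q2 : q.2 = t * p.2 by lra.
  by rewrite /cross q1 q2; ring.
apply: line_unique q0 (proj1 (line_ends _ _)) _.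
by exists t; rewrite qE /affine2 /vadd /=; congr (_, _); ring.
Qed.

Lemma card_ord_setT n : ([set: 'I_n] #= `I_n)%card.
Proof.
apply: card_esym; rewrite (_ : `I_n = [set val i | i in [set: 'I_n]]).
  by apply: inj_card_eq => i j _ _ /val_inj.
apply/seteqP; split=> [k kn|_ [i _ <-]]; last exact: ltn_ord.
by exists (Ordinal kn).
Qed.

(** If two indices had the same image, omitting one of them would leave at most
    m - 1 values. *)
Lemma card_image_inj (X : Type) m (g : 'I_m -> X) :
  ([set g i | i in [set: 'I_m]] #= `I_m)%card -> injective g.
Proof.
case: m g => [|m] g; first by move=> _ [].
move=> cg i j gij; apply: contrapT => /eqP ij.
suff : (`I_m.+1 #<= `I_m)%card by rewrite card_le_II ltnn.
rewrite -(card_le_eql cg) -(card_le_eqr (card_ord_setT m)).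
suff -> : [set g i | i in [set: 'I_m.+1]] =
    [set (g \o lift j) k | k in [set: 'I_m]] by apply: card_image_le.
apply/seteqP; split=> [_ [k _ <-]|_ [k _ <-]]; last by exists (lift j k).
have [kj|jk] := eqVneq k j.
  rewrite eq_sym in ij; have [l il _] := unlift_some ij.
  by exists l => //=; rewrite kj -gij il.
by rewrite eq_sym in jk; have [l kl _] := unlift_some jk; exists l => //=; rewrite -kl.
Qed.

Section Slopes.
Variables (v : plane) (m : nat) (Delta : set (set plane)) (T : 'I_m -> set plane)
  (p : 'I_m -> plane) (s : 'I_m -> 'I_m).
Hypotheses (Hfan : fan v T p s) (DT : forall A, Delta A <-> exists i, A = T i).

Definition edge_line i := line_through v (vadd v (p i)).

Lemma slopes_lines : slopes v Delta = [set edge_line i | i in [set: 'I_m]].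
Proof.
apply/seteqP; split=> [L [[a [b [_ ->]]] Lv [e [ev [A /DT[i ->]]]]]|_ [i _ <-]].
  rewrite (fan_tri Hfan) => eT eL.
  have [k eE] : exists k, e = segment v (vadd v (p k)).
    by case: (tri_edge (fan_pos Hfan i) eT ev) => ->; eexists.
  exists k => //; apply/esym/line_unique => //; first exact: fan_neq0 Hfan k.
  apply: eL; rewrite eE; exists 1; first lra.
  by rewrite /affine2 /vadd /=; congr (_, _); ring.
split; [|exact: (proj1 (line_ends _ _))|].
  exists v, (vadd v (p i)); split=> // /plane_eq[h1 h2].
  by apply: (fan_neq0 Hfan i); rewrite [p i]surjective_pairing; congr (_, _); lra.
exists (segment v (vadd v (p i))); last by move=> x [t _ ->]; exists t.
split; first by exists 0; [lra|rewrite {1}[v]surjective_pairing /affine2; congr (_, _); ring].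
exists (T i); first by apply/DT; exists i.
rewrite (fan_tri Hfan); apply: tri_edge_p; exact: fan_pos Hfan i.
Qed.

Lemma slopes_inj mv : (slopes v Delta #= `I_mv)%card -> mv = m -> injective edge_line.
Proof.
by rewrite slopes_lines => cmv mvm; rewrite mvm in cmv; apply: card_image_inj cmv.
Qed.

Lemma slopes_not_inj mv : (slopes v Delta #= `I_mv)%card -> (mv < m)%N ->
  exists i j, i != j /\ edge_line i = edge_line j.
Proof.
rewrite slopes_lines => cmv mvm; apply: contrapT => h.
suff : m = mv by move=> e; rewrite e ltnn in mvm.
apply/card_eq_II; apply: card_eq_trans (card_esym (card_ord_setT m)) _.
apply: card_eq_trans cmv; apply: card_esym; apply: inj_card_eq => i j _ _ ij.
by apply: contrapT => /eqP nij; apply: h; exists i, j.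
Qed.
End Slopes.

(** * The order of supersmoothness *)

Section Supersmoothness.
Import GRing.Theory.

Lemma agree_at_sym k f g x : agree_at k f g x -> agree_at k g f x.
Proof. by move=> fg a b ab; rewrite fg. Qed.

(** [lform (q.2, - q.1)] is the equation of the line spanned by q. *)
Lemma conormal_neq0 (q : plane) : q <> (0, 0) -> (lform (q.2, - q.1) != 0)%R.
Proof.
move=> q0; apply/eqP => /polyP l0; apply: q0.
have := l0 1%N; have := l0 0%N.
rewrite !coefD !coefC !coefZ !coefX /= mulr0 mulr1 addr0 add0r => e2 e1.
rewrite [q]surjective_pairing; congr (_, _) => //; move: e1.
by rewrite -[X in X = _]/(- q.1) -[X in _ = X]/0; lra.
Qed.

Lemma lform_conormal_scale t (q : plane) :
  lform ((vscale t q).2, - (vscale t q).1) = (t *: lform (q.2, Ropp q.1))%R.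
Proof.
rewrite /lform /= scalerDr scalerA -[(_ *: _%:P)%R]mul_polyC -polyCM.
congr (_ + _ *: _)%R; exact: Ropp_mult_distr_r.
Qed.

Section Cell.
Variables (v : plane) (I : finType) (T : I -> set plane) (p : I -> plane) (s : I -> I)
  (Delta : set (set plane)).
Hypotheses (Hfan : fan v T p s) (T_inj : injective T)
  (DT : forall A, Delta A <-> exists i, A = T i).

Let DTi i : Delta (T i).
Proof. by apply/DT; exists i. Qed.

(** Up to order r the edge condition holds at v itself.  Above, [jets_vanish]
    applies with e = d - r to the jumps J i across the edge from T i to T (s i);
    their sum telescopes around the cycle. *)
Lemma spline_jets_agree r d (sigma : family) : smooth_spline r Delta sigma ->
  (d <= r)%N \/ (forall i j, i != j -> cross (p i) (p j) <> 0) /\ (#|I| * (d - r) <= d.+1)%N ->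
  forall i a b, (a + b)%N = d ->
  jet (fct (sigma (T (s i)))) v a b = jet (fct (sigma (T i))) v a b.
Proof.
move=> [spl agr] dr.
pose f i := fct (sigma (T i)).
have agE i x : segment v (vadd v (p (s i))) x -> agree_at r (f (s i)) (f i) x.
  have [ce E] := fan_edge Hfan i; rewrite -E => xE.
  exact/agree_at_sym/(agr _ _ (DTi _) (DTi _) ce).
have seg i t : 0 <= t <= 1 -> segment v (vadd v (p (s i))) (along v (p (s i)) t).
  by move=> t01; exists t; rewrite // /along /affine2 /vadd /=; congr (_, _); ring.
have v0 u : along v u 0 = v.
  by rewrite /along !Rmult_0_l !Rplus_0_r -surjective_pairing.
have [le_dr|lt_rd] := leqP d r.
  move=> i a b ab; apply: agE; last by rewrite ab.
  by rewrite -[X in segment _ _ X](v0 (p (s i))); apply: seg; lra.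
case: dr => [|[np le_d]]; first by rewrite leqNgt lt_rd.
pose J i a b : R := (jet (f (s i)) v a b - jet (f i) v a b)%R.
have JE d' P i : pairing d' P (J i) =
    (pairing d' P (jet (f (s i)) v) - pairing d' P (jet (f i) v))%R.
  rewrite -sumrB; apply: eq_bigr => j _; by rewrite mulrBr.
have s_inj := fan_inj Hfan.
have van : forall i (P : {poly R}), (size P <= d.+1)%N -> pairing d P (J i) = 0.
  apply: (@jets_vanish _ I (p \o s) (d - r) d J) => //.
  - move=> [i j]; rewrite inE /= => ij; apply/eqP.
    by apply: np; rewrite (inj_eq s_inj).
  - move=> x y; rewrite sumrB.
    by rewrite [X in (_ - X)%R](reindex_inj s_inj) subrr.
  - move=> i S sS; rewrite JE; apply/eqP; rewrite subr_eq0; apply/eqP.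
    have {1 3}-> : d = (d - r + r)%N by rewrite subnK // ltnW.
    have [oi ti si] := spl _ (DTi i); have [oj tj sj] := spl _ (DTi (s i)).
    have domE t : 0 <= t <= 1 ->
        (dom (sigma (T i)) `&` dom (sigma (T (s i)))) (along v (p (s i)) t).
      move=> /(seg i); have [_ <-] := fan_edge Hfan i.
      by move=> [h1 h2]; split; [apply: ti|apply: tj].
    apply: (@pairing_agree (dom (sigma (T i)) `&` dom (sigma (T (s i))))).
    + exact: open_and.
    + by move=> x [_ xj]; apply: sj.
    + by move=> x [xi _]; apply: si.
    + by rewrite -(v0 (p (s i))); apply: domE; lra.
    + move=> t t01; split; first by apply: domE; lra.
      by apply/agE/seg; lra.
    + by move: sS; rewrite subSn ?leq_subr // subKn // ltnW.
move=> i a b ab.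
have bd : (b <= d)%N by rewrite -ab leq_addl.
have := van i ('X^b)%R; rewrite size_polyXn ltnS => /(_ bd).
rewrite pairingXn // -{1}ab addnK /J => /eqP; rewrite subr_eq0 => /eqP.
by [].
Qed.

(** Any triangle is reached from any other through successors. *)
Lemma smooth_vertex_of_jets r rho (sigma : family) : smooth_spline r Delta sigma ->
  (forall d, (d <= rho)%N -> forall i a b, (a + b)%N = d ->
    jet (fct (sigma (T (s i)))) v a b = jet (fct (sigma (T i))) v a b) ->
  smooth_at_vertex rho v Delta sigma.
Proof.
move=> [spl _] succ; split=> // A B /DT[i ->] /DT[j ->] a b ab.
rewrite -(iter_findex (fan_conn Hfan i j)); elim: (findex s i j) => [|n IH] //.
by rewrite IH iterS; apply/esym; apply: (succ _ ab _ _ _ erefl).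
Qed.

(** Polynomials F i with jumps G i = l_i^(r+1) Q i exist since the G i add up to
    zero.  The factor l_i^(r+1) makes the spline C^r across edge i, while a
    nonzero G i gives different derivatives of order r + 1 + k at v. *)
Lemma syzygy_bounds_order r k (Q : I -> {poly R}) :
  (forall i, size (Q i) <= k.+1)%N ->
  (\sum_i lform ((p i).2, - (p i).1) ^+ r.+1 * Q i = 0)%R ->
  (exists i, Q i != 0)%R ->
  forall rho, supersmoothness_orders r v Delta rho -> (rho <= r + k)%N.
Proof.
move=> sQ sumQ [i0 Q0] rho [_ sub].
rewrite leqNgt; apply/negP => lt_rho.
pose n i : plane := ((p i).2, - (p i).1).
pose G i : {poly R} := (lform (n i) ^+ r.+1 * Q i)%R.
pose d := (r.+1 + k)%N.
have s_inj := fan_inj Hfan.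
have [F FE] := cyclic_potential s_inj (fan_conn Hfan) sumQ.
have /choice[idx idxT] A : exists i, (exists j, A = T j) -> A = T i.
  by have [[j ->]|nA] := pselect (exists j, A = T j); [exists j|exists i0].
have idxK i : idx (T i) = i.
  by apply/T_inj/esym/idxT; exists i.
pose f i := homog v d (F i).
pose g i := homog v d (G i).
have fE i : f (s i) = (fun x y => f i x y + g (s i) x y).
  by apply/funext => x; apply/funext => y; rewrite /f FE homogD.
have partial_f i a b x : jet (f (s i)) x a b = jet (f i) x a b + jet (g (s i)) x a b.
  rewrite /jet fE.
  by have [-> _] := partial_add a b (polyfun_homog v d (F i)) (polyfun_homog v d (G (s i))).
have gE i : g i = (fun x y => linform v (n i) x y ^ r.+1 * homog v k (Q i) x y).
  by apply/funext => x; apply/funext => y; apply: homog_lformX.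
have g_edge i x a b : segment v (vadd v (p i)) x -> (a + b <= r)%N -> jet (g i) x a b = 0.
  move=> [t _ ->] ab; rewrite /jet gE.
  apply: (partial_vanish (lx := (n i).1) (ly := (n i).2)) => //.
  - exact: polyfun_linform.
  - by move=> x0 y0; have [] := is_derive_linform v (n i) x0 y0.
  - by move=> x0 y0; have [] := is_derive_linform v (n i) x0 y0.
  - exact: polyfun_homog.
  - rewrite /linform /n /=; ring.
have f_edge i x : segment v (vadd v (p (s i))) x -> agree_at r (f i) (f (s i)) x.
  move=> xe a b ab; have := partial_f i a b x.
  by rewrite g_edge // Rplus_0_r.
pose sigma : family := fun A => Piece setT (f (idx A)).
have ss : smooth_spline r Delta sigma.
  split=> [A _|A B /DT[i ->] /DT[j ->] ce x xe] /=.
    split=> //; first by move=> q _; apply: filter_true.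
    exact/polyfun_smooth/polyfun_homog.
  rewrite !idxK; have [<-//|ij] := eqVneq i j.
  have [e|e] := fan_adj Hfan ij ce; rewrite e in ce xe *.
    by apply: f_edge; have [_ <-] := fan_edge Hfan i.
  by apply/agree_at_sym/f_edge; have [_ <-] := fan_edge Hfan j; rewrite setIC.
have [_ agr] := sub _ ss.
have [i si] : exists i, s i = i0 by exists (finv s i0); rewrite f_finv.
have sG : (size (G i0) <= d.+1)%N by rewrite /d -addnS size_lformXM.
have [|a [b [ab]]] := homog_jet_neq0 v sG.
  by rewrite mulf_neq0 // expf_neq0 // conormal_neq0 //; apply: (fan_neq0 Hfan).
apply; have := partial_f i a b v; rewrite si /jet /g.
have := agr _ _ (DTi i) (DTi i0) a b; rewrite /= !idxK ab /d addSn => /(_ lt_rho).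
lra.
Qed.
End Cell.

End Supersmoothness.

Theorem theorem2 (v : plane) (m mv : nat) (Delta : set (set plane))
    (cell : interior_cell v m Delta)
    (hmv : (slopes v Delta #= `I_mv)%card) (r : nat) :
  (mv = m -> is_mos r v Delta (r + (r + 1) %/ (m - 1))%N) /\
  ((mv < m)%N -> is_mos r v Delta r).
Proof.
have [T [p [s [Hfan T_inj DT]]]] := cell_fan cell.
have p0 := fan_neq0 Hfan.
have [i0] : exists i0 : 'I_m, True.
  have [_ _ _ /locally_singleton[A /DT[i _] _]] := cell; by exists i.
move=> _.
have si i : s i != i.
  by apply/eqP => e; have := fan_pos Hfan i; rewrite e /cross; lra.
have m_gt1 : (1 < m)%N.
  have := ltn_ord i0; have := ltn_ord (s i0); have := si i0.
  rewrite -val_eqE /=; lia.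
split=> hm.
  have inj := slopes_inj Hfan DT hmv hm.
  have np i j : i != j -> cross (p i) (p j) <> 0.
    by move=> ij c; move/eqP: ij; apply; apply/inj/line_cross.
  split; last first.
    have [|Q [sQ sumQ Q0]] := @syzygy_exists _ 'I_m (fun i => ((p i).2, - (p i).1)) r.+1
        ((r + 1) %/ (m - 1)).
      (* The count of coefficients amounts to r + 1 < (m - 1) (k + 1). *)
      rewrite card_ord.
      have := @ltn_ceil (r + 1) (m - 1); rewrite subn_gt0 => /(_ m_gt1).
      move: (_ %/ _)%N => q; rewrite mulnBr muln1 [(q.+1 * m)%N]mulnC; lia.
    exact: (syzygy_bounds_order Hfan T_inj DT sQ sumQ Q0).
  split; first exact: leq_addr.
  move=> sigma ss; apply: (smooth_vertex_of_jets Hfan DT ss) => d le_d.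
  apply: (spline_jets_agree Hfan DT ss); right; split=> //.
  have : (d - r <= (r + 1) %/ (m - 1))%N by rewrite leq_subLR.
  rewrite card_ord leq_divRL ?subn_gt0 // mulnBr muln1 mulnC; lia.
split; last first.
  have [i [j [ij e]]] := slopes_not_inj Hfan DT hmv hm.
  have [t tE] := cross_eq0_scale (p0 i) (proj1 (line_cross v (p0 i) (p0 j)) e).
  have [|Q [sQ sumQ Q0]] := proportional_syzygy r.+1
      (a := fun l => ((p l).2, - (p l).1)) (t := t) ij.
    by rewrite tE lform_conormal_scale.
  move=> rho; rewrite -[X in (_ <= X)%N]addn0.
  exact: (syzygy_bounds_order Hfan T_inj DT sQ sumQ Q0).
split=> // sigma ss; apply: (smooth_vertex_of_jets Hfan DT ss) => d le_d.
by apply: (spline_jets_agree Hfan DT ss); left.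
Qed.
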